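(* For a countably-based $T_0$ space $X$, the following are equivalent: (1) $X$ is domain-complete; (2) $X$ is LCS-complete; (3) $X$ is quasi-Polish; (4) $X$ is compactly Choquet-complete; (5) $X$ is convergence Choquet-complete.
   Context: A space is domain-complete (resp. LCS-complete) if it is homeomorphic to a $G_\delta$ subset (countable intersection of open sets), with the subspace topology, of some continuous dcpo with its Scott topology (resp. of some locally compact sober space, locally compact meaning every point has a neighborhood base of compact saturated sets). A quasi-Polish space is a space homeomorphic to a quasi-metric space $X,d$ with its open ball topology, where $d$ is Smyth-complete (every $d$-Cauchy sequence, i.e. forward Cauchy sequence, converges in the topology of the symmetrized metric $d^{sym}(x,y)=\max(d(x,y),d(y,x))$) and separable (there is a countable subset dense for the $d^{sym}$ topology). Strong Choquet game: players $\beta$ and $\alpha$ alternate; at round $n$, $\beta$ picks a point $x_n$ and an open neighborhood $V_n$ of $x_n$ with $V_n\subseteq U_{n-1}$ (when $n\ge1$), and $\alpha$ picks an open $U_n$ with $x_n\in U_n\subseteq V_n$; strategies may depend on the whole history. $X$ is convergence Choquet-complete if $\alpha$ has a strategy ensuring $(U_n)_n$ is a base of open neighborhoods of some point, and compactly Choquet-complete if $\alpha$ has a strategy ensuring $(U_n)_n$ is a base of open neighborhoods of some non-empty compact saturated set. *)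

(* Defs.v *)
From Stdlib Require Import Reals List.
Open Scope R_scope.

Definition subset {X : Type} (A B : X -> Prop) : Prop := forall x, A x -> B x.

Definition is_topology {X : Type} (O : (X -> Prop) -> Prop) : Prop :=
  O (fun _ => True) /\
  (forall U V, O U -> O V -> O (fun x => U x /\ V x)) /\
  (forall F : (X -> Prop) -> Prop,
      (forall U, F U -> O U) -> O (fun x => exists U, F U /\ U x)).

Definition closed {X : Type} (O : (X -> Prop) -> Prop) (C : X -> Prop) : Prop :=
  O (fun x => ~ C x).

Definition T0 {X : Type} (O : (X -> Prop) -> Prop) : Prop :=
  forall x y, x <> y -> exists U, O U /\ ~ (U x <-> U y).

Definition countably_based {X : Type} (O : (X -> Prop) -> Prop) : Prop :=
  exists B : nat -> (X -> Prop),
    (forall n, O (B n)) /\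
    (forall U, O U -> forall x, U x -> exists n, B n x /\ subset (B n) U).

Definition subspace {Y : Type} (O : (Y -> Prop) -> Prop) (S : Y -> Prop)
  : ({y : Y | S y} -> Prop) -> Prop :=
  fun W => exists V, O V /\ forall p : {y : Y | S y}, W p <-> V (proj1_sig p).

Definition continuous {X Y : Type} (OX : (X -> Prop) -> Prop)
  (OY : (Y -> Prop) -> Prop) (f : X -> Y) : Prop :=
  forall V, OY V -> OX (fun x => V (f x)).

Definition homeomorphic {X Y : Type} (OX : (X -> Prop) -> Prop)
  (OY : (Y -> Prop) -> Prop) : Prop :=
  exists (f : X -> Y) (g : Y -> X),
    (forall x, g (f x) = x) /\ (forall y, f (g y) = y) /\
    continuous OX OY f /\ continuous OY OX g.

Definition G_delta {Y : Type} (O : (Y -> Prop) -> Prop) (S : Y -> Prop) : Prop :=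
  exists U : nat -> (Y -> Prop),
    (forall n, O (U n)) /\ forall y, S y <-> (forall n, U n y).

Definition compact {X : Type} (O : (X -> Prop) -> Prop) (Q : X -> Prop) : Prop :=
  forall F : (X -> Prop) -> Prop,
    (forall U, F U -> O U) ->
    (forall x, Q x -> exists U, F U /\ U x) ->
    exists l : list (X -> Prop),
      (forall U, In U l -> F U) /\ (forall x, Q x -> exists U, In U l /\ U x).

Definition saturated {X : Type} (O : (X -> Prop) -> Prop) (Q : X -> Prop) : Prop :=
  forall y, (forall U, O U -> subset Q U -> U y) -> Q y.

Definition is_poset {D : Type} (le : D -> D -> Prop) : Prop :=
  (forall x, le x x) /\
  (forall x y z, le x y -> le y z -> le x z) /\
  (forall x y, le x y -> le y x -> x = y).

Definition directed {D : Type} (le : D -> D -> Prop) (A : D -> Prop) : Prop :=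
  (exists a, A a) /\
  (forall a b, A a -> A b -> exists c, A c /\ le a c /\ le b c).

Definition is_sup {D : Type} (le : D -> D -> Prop) (A : D -> Prop) (s : D) : Prop :=
  (forall a, A a -> le a s) /\ (forall u, (forall a, A a -> le a u) -> le s u).

Definition is_dcpo {D : Type} (le : D -> D -> Prop) : Prop :=
  is_poset le /\ forall A, directed le A -> exists s, is_sup le A s.

Definition way_below {D : Type} (le : D -> D -> Prop) (x y : D) : Prop :=
  forall A s, directed le A -> is_sup le A s -> le y s ->
    exists a, A a /\ le x a.

Definition is_continuous_dcpo {D : Type} (le : D -> D -> Prop) : Prop :=
  is_dcpo le /\
  forall x, directed le (fun y => way_below le y x) /\
            is_sup le (fun y => way_below le y x) x.

Definition scott_open {D : Type} (le : D -> D -> Prop) (U : D -> Prop) : Prop :=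
  (forall x y, U x -> le x y -> U y) /\
  (forall A s, directed le A -> is_sup le A s -> U s -> exists a, A a /\ U a).

Definition irreducible_closed {X : Type} (O : (X -> Prop) -> Prop) (C : X -> Prop) : Prop :=
  closed O C /\ (exists x, C x) /\
  forall A B, closed O A -> closed O B ->
    subset C (fun x => A x \/ B x) -> subset C A \/ subset C B.

Definition point_closure {X : Type} (O : (X -> Prop) -> Prop) (x : X) : X -> Prop :=
  fun y => forall A, closed O A -> A x -> A y.

Definition sober {X : Type} (O : (X -> Prop) -> Prop) : Prop :=
  forall C, irreducible_closed O C ->
    exists x, (forall y, C y <-> point_closure O x y) /\
      forall x', (forall y, C y <-> point_closure O x' y) -> x' = x.

Definition locally_compact {X : Type} (O : (X -> Prop) -> Prop) : Prop :=
  forall x U, O U -> U x ->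
    exists Q, compact O Q /\ saturated O Q /\
      (exists V, O V /\ V x /\ subset V Q) /\ subset Q U.

Definition is_quasi_metric {X : Type} (d : X -> X -> R) : Prop :=
  (forall x y, 0 <= d x y) /\
  (forall x, d x x = 0) /\
  (forall x y z, d x z <= d x y + d y z) /\
  (forall x y, d x y = 0 -> d y x = 0 -> x = y).

Definition ball_open {X : Type} (d : X -> X -> R) (U : X -> Prop) : Prop :=
  forall x, U x -> exists eps, 0 < eps /\ forall y, d x y < eps -> U y.

Definition dsym {X : Type} (d : X -> X -> R) : X -> X -> R :=
  fun x y => Rmax (d x y) (d y x).

Definition d_Cauchy {X : Type} (d : X -> X -> R) (s : nat -> X) : Prop :=
  forall eps, 0 < eps -> exists N, forall m n, (N <= m)%nat -> (m <= n)%nat ->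
    d (s m) (s n) < eps.

Definition converges_in {X : Type} (O : (X -> Prop) -> Prop) (s : nat -> X) (x : X) : Prop :=
  forall U, O U -> U x -> exists N, forall n, (N <= n)%nat -> U (s n).

Definition smyth_complete {X : Type} (d : X -> X -> R) : Prop :=
  forall s, d_Cauchy d s -> exists x, converges_in (ball_open (dsym d)) s x.

Definition countable_set {X : Type} (A : X -> Prop) : Prop :=
  exists e : nat -> option X, forall x, A x <-> exists n, e n = Some x.

Definition qm_separable {X : Type} (d : X -> X -> R) : Prop :=
  exists A : X -> Prop, countable_set A /\
    forall U, ball_open (dsym d) U -> (exists x, U x) -> exists a, A a /\ U a.

Definition domain_complete {X : Type} (O : (X -> Prop) -> Prop) : Prop :=
  exists (D : Type) (le : D -> D -> Prop), is_continuous_dcpo le /\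
    exists S : D -> Prop, G_delta (scott_open le) S /\
      homeomorphic O (subspace (scott_open le) S).

Definition LCS_complete {X : Type} (O : (X -> Prop) -> Prop) : Prop :=
  exists (Y : Type) (OY : (Y -> Prop) -> Prop),
    is_topology OY /\ locally_compact OY /\ sober OY /\
    exists S : Y -> Prop, G_delta OY S /\ homeomorphic O (subspace OY S).

Definition quasi_Polish {X : Type} (O : (X -> Prop) -> Prop) : Prop :=
  exists (Y : Type) (d : Y -> Y -> R),
    is_quasi_metric d /\ smyth_complete d /\ qm_separable d /\
    homeomorphic O (ball_open d).

(* A strategy for alpha maps the history of beta's moves (x_0,V_0),...,(x_n,V_n)
   to alpha's answer U_n (alpha's own earlier moves are determined by it). *)
Definition history {X : Type} (x : nat -> X) (V : nat -> (X -> Prop)) (n : nat)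
  : list (X * (X -> Prop)) :=
  map (fun i => (x i, V i)) (seq 0 (S n)).

Definition alpha_move {X : Type} (sigma : list (X * (X -> Prop)) -> (X -> Prop))
  (x : nat -> X) (V : nat -> (X -> Prop)) (n : nat) : X -> Prop :=
  sigma (history x V n).

Definition beta_legal {X : Type} (O : (X -> Prop) -> Prop)
  (sigma : list (X * (X -> Prop)) -> (X -> Prop))
  (x : nat -> X) (V : nat -> (X -> Prop)) (n : nat) : Prop :=
  O (V n) /\ V n (x n) /\
  match n with
  | O => True
  | S m => subset (V n) (alpha_move sigma x V m)
  end.

Definition alpha_legal {X : Type} (O : (X -> Prop) -> Prop)
  (sigma : list (X * (X -> Prop)) -> (X -> Prop))
  (x : nat -> X) (V : nat -> (X -> Prop)) (n : nat) : Prop :=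
  O (alpha_move sigma x V n) /\ alpha_move sigma x V n (x n) /\
  subset (alpha_move sigma x V n) (V n).

Definition alpha_winning {X : Type} (O : (X -> Prop) -> Prop)
  (win : (nat -> (X -> Prop)) -> Prop)
  (sigma : list (X * (X -> Prop)) -> (X -> Prop)) : Prop :=
  forall (x : nat -> X) (V : nat -> (X -> Prop)),
    (forall n, (forall k, (k <= n)%nat -> beta_legal O sigma x V k) ->
               alpha_legal O sigma x V n) /\
    ((forall n, beta_legal O sigma x V n) -> win (alpha_move sigma x V)).

Definition nbhd_base_of_point {X : Type} (O : (X -> Prop) -> Prop)
  (U : nat -> (X -> Prop)) : Prop :=
  exists z, (forall n, O (U n) /\ U n z) /\
    forall W, O W -> W z -> exists n, subset (U n) W.

Definition nbhd_base_of_compact {X : Type} (O : (X -> Prop) -> Prop)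
  (U : nat -> (X -> Prop)) : Prop :=
  exists Q, (exists q, Q q) /\ compact O Q /\ saturated O Q /\
    (forall n, O (U n) /\ subset Q (U n)) /\
    forall W, O W -> subset Q W -> exists n, subset (U n) W.

Definition convergence_Choquet_complete {X : Type} (O : (X -> Prop) -> Prop) : Prop :=
  exists sigma, alpha_winning O (nbhd_base_of_point O) sigma.

Definition compactly_Choquet_complete {X : Type} (O : (X -> Prop) -> Prop) : Prop :=
  exists sigma, alpha_winning O (nbhd_base_of_compact O) sigma.

(* Main.v *)
(** From a winning strategy of alpha in the compact game and a countable base (B i)
    one extracts a countable tree of plays in which beta only plays traces of
    basic open sets.  The tree yields countably many axioms of the form "if A
    contains the finite set F n, then A meets W n" on sets A of indices, all true
    of {i | x in B i}; conversely, the basic neighbourhood filter of the compact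
    set produced by the branch followed by a model A is A itself, and the axioms
    "B k is covered by finitely many B i" make it prime, so that A comes from a point.
    Such a presentation exhibits X both as the G_delta set of unbounded ideals
    of a countable poset of finite stages, and as a separable Smyth-complete
    quasi-metric space whose distance records the least witnesses of the axioms.
    The circle is closed by: continuous dcpos are locally compact and sober;
    sober spaces are well-filtered, so that alpha wins in a G_delta subset of a
    locally compact sober space with compact neighbourhoods; alpha wins in a
    Smyth-complete space with shrinking balls. *)

From Stdlib Require Import Reals List Lia Lra Arith Cantor.
From Stdlib Require Import Classical ClassicalEpsilon FunctionalExtensionality
  PropExtensionality ProofIrrelevance.
From mathcomp Require classical_sets.
Require Import Defs.

(** * Topological preliminaries *)

Lemma pred_ext {X : Type} (U V : X -> Prop) : (forall x, U x <-> V x) -> U = V.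
Proof.
  intros H. apply functional_extensionality. intros x.
  apply propositional_extensionality. apply H.
Qed.

Lemma least_nat (P : nat -> Prop) :
  (exists n, P n) -> exists n, P n /\ forall m, P m -> (n <= m)%nat.
Proof.
  intros [n Hn]. revert Hn. induction n as [n IH] using lt_wf_ind. intros Hn.
  destruct (classic (exists m, (m < n)%nat /\ P m)) as [[m [Hm Pm]]|Hno].
  - exact (IH m Hm Pm).
  - exists n. split; [exact Hn|]. intros m Pm.
    destruct (le_lt_dec n m) as [H|H]; [exact H|].
    exfalso. apply Hno. exists m. auto.
Qed.

Section Topology.
Context {X : Type} {O : (X -> Prop) -> Prop}.
Hypothesis Htop : is_topology O.

Lemma open_of_nbhds (U : X -> Prop) :
  (forall x, U x -> exists V, O V /\ V x /\ subset V U) -> O U.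
Proof.
  intros H. destruct Htop as [_ [_ Hun]].
  replace U with (fun x => exists V, (O V /\ subset V U) /\ V x).
  - apply Hun. intros V [HV _]. exact HV.
  - apply pred_ext. intros x. split.
    + intros [V [[_ HVU] Vx]]. exact (HVU x Vx).
    + intros Ux. destruct (H x Ux) as [V [OV [Vx HVU]]]. exists V. auto.
Qed.

Lemma open_full : O (fun _ => True).
Proof. exact (proj1 Htop). Qed.

Lemma open_inter (U V : X -> Prop) : O U -> O V -> O (fun x => U x /\ V x).
Proof. exact (proj1 (proj2 Htop) U V). Qed.

Lemma open_union (U V : X -> Prop) : O U -> O V -> O (fun x => U x \/ V x).
Proof.
  intros OU OV. apply open_of_nbhds. intros x [Ux|Vx].
  - exists U. split; [exact OU|]. split; [exact Ux|]. intros y Uy. left. exact Uy.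
  - exists V. split; [exact OV|]. split; [exact Vx|]. intros y Vy. right. exact Vy.
Qed.

Lemma open_list_inter {I : Type} (B : I -> X -> Prop) (HB : forall i, O (B i)) (F : list I) :
  O (fun x => forall i, In i F -> B i x).
Proof.
  induction F as [|a F IH].
  - replace (fun x : X => forall i, In i nil -> B i x) with (fun _ : X => True).
    + apply open_full.
    + apply pred_ext. intros x. split; [intros _ i []|auto].
  - replace (fun x : X => forall i, In i (a :: F) -> B i x)
      with (fun x => B a x /\ forall i, In i F -> B i x).
    + apply open_inter; auto.
    + apply pred_ext. intros x. split.
      * intros [Ha HF] i [<-|Hi]; auto.
      * intros H. split; [apply H; left; reflexivity|]. intros i Hi. apply H. right. exact Hi.
Qed.

End Topology.

(** * Strategies with memory *)

Lemma history_S {X : Type} (x : nat -> X) (V : nat -> X -> Prop) (n : nat) :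
  map (fun i => (x i, V i)) (seq 0 (S n)) =
  map (fun i => (x i, V i)) (seq 0 n) ++ (x n, V n) :: nil.
Proof. rewrite seq_S, map_app. reflexivity. Qed.

Section StatefulStrategies.
Context {X : Type} {O : (X -> Prop) -> Prop}.
Variables (T : Type) (t0 : T) (inv : T -> Prop) (out : T -> X -> Prop).
Variable next : T -> X -> (X -> Prop) -> T -> Prop.

Definition good_step (t : T) (x : X) (V : X -> Prop) (t' : T) : Prop :=
  next t x V t' /\ inv t' /\ O (out t') /\ out t' x /\ subset (out t') V.

(** A strategy sees only beta's moves, so alpha's memory is recomputed by folding a chosen
    [good_step] over the history. The state [t n] precedes round [n]; alpha's answer in that round
    is therefore [out (t (S n))]. *)
Lemma stateful_strategy (win : (nat -> (X -> Prop)) -> Prop) :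
  inv t0 -> (forall x, out t0 x) ->
  (forall t x V, inv t -> O V -> V x -> subset V (out t) -> exists t', good_step t x V t') ->
  (forall x V t, t 0%nat = t0 ->
     (forall n, V n (x n) /\ subset (V n) (out (t n))) ->
     (forall n, good_step (t n) (x n) (V n) (t (S n))) ->
     win (fun n => out (t (S n)))) ->
  exists sigma, alpha_winning O win sigma.
Proof.
  intros inv0 out0 Hstep Hwin.
  pose (step := fun t (p : X * (X -> Prop)) =>
    epsilon (inhabits t0) (good_step t (fst p) (snd p))).
  exists (fun h => out (fold_left step h t0)).
  intros x V.
  pose (t := fun n => fold_left step (map (fun i => (x i, V i)) (seq 0 n)) t0).
  set (sigma := fun h => out (fold_left step h t0)).
  assert (HtS : forall n, t (S n) = step (t n) (x n, V n)).
  { intros n. unfold t. rewrite history_S, fold_left_app. reflexivity. }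
  assert (Hbeta : forall n, beta_legal O sigma x V n ->
            O (V n) /\ V n (x n) /\ subset (V n) (out (t n))).
  { intros [|n] [H1 [H2 H3]]; (split; [exact H1|split; [exact H2|]]).
    - intros y _. apply out0.
    - exact H3. }
  assert (Hgood : forall n, inv (t n) -> beta_legal O sigma x V n ->
            good_step (t n) (x n) (V n) (t (S n))).
  { intros n Hinv Hb. destruct (Hbeta n Hb) as [H1 [H2 H3]].
    rewrite HtS. unfold step. apply epsilon_spec. apply Hstep; assumption. }
  assert (Hinv : forall n, (forall k, (k < n)%nat -> beta_legal O sigma x V k) -> inv (t n)).
  { induction n as [|n IH]; intros Hb; [exact inv0|].
    apply (Hgood n); [apply IH; intros k Hk; apply Hb; lia|apply Hb; lia]. }
  split.
  - intros n Hb. destruct (Hgood n) as [_ [_ H]].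
    + apply Hinv. intros k Hk. apply Hb. lia.
    + apply Hb. lia.
    + exact H.
  - intros Hb. apply (Hwin x V t); [reflexivity| |].
    + intros n. exact (proj2 (Hbeta n (Hb n))).
    + intros n. apply Hgood; [apply Hinv; intros k _; apply Hb|apply Hb].
Qed.

End StatefulStrategies.

Lemma nested_nat {X : Type} (U : nat -> X -> Prop) :
  (forall n, subset (U (S n)) (U n)) -> forall m n, (m <= n)%nat -> subset (U n) (U m).
Proof.
  intros H m n Hmn. induction Hmn as [|n _ IH]; [intros x Hx; exact Hx|].
  intros x Hx. apply IH, H, Hx.
Qed.

(** * Quasi-Polish spaces are convergence Choquet-complete *)

Lemma dsym_quasi_metric {X : Type} (d : X -> X -> R) :
  is_quasi_metric d -> is_quasi_metric (dsym d).
Proof.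
  intros [Hpos [Hrefl [Htri Hsep]]]. unfold dsym. repeat split.
  - intros x y. apply Rle_trans with (d x y); [apply Hpos|apply Rmax_l].
  - intros x. rewrite Hrefl. apply Rmax_left, Rle_refl.
  - intros x y z.
    pose proof (Htri x y z). pose proof (Htri z y x).
    pose proof (Rmax_l (d x y) (d y x)). pose proof (Rmax_r (d x y) (d y x)).
    pose proof (Rmax_l (d y z) (d z y)). pose proof (Rmax_r (d y z) (d z y)).
    apply Rmax_lub; lra.
  - intros x y H1 _.
    pose proof (Rmax_l (d x y) (d y x)). pose proof (Rmax_r (d x y) (d y x)).
    pose proof (Hpos x y). pose proof (Hpos y x).
    apply Hsep; lra.
Qed.

Lemma ball_is_open {X : Type} (d : X -> X -> R) (x : X) (r : R) :
  is_quasi_metric d -> ball_open d (fun y => d x y < r).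
Proof.
  intros [Hpos [Hrefl [Htri Hsep]]] y Hy. exists (r - d x y). split; [lra|].
  intros z Hz. pose proof (Htri x y z). lra.
Qed.

(** Pulling the distance back along the homeomorphism lets the game be played on [X] itself. *)
Lemma quasi_Polish_metrization {X : Type} (O : (X -> Prop) -> Prop) :
  quasi_Polish O -> exists d : X -> X -> R,
    is_quasi_metric d /\ smyth_complete d /\ forall U, O U <-> ball_open d U.
Proof.
  intros [Y [d [[Hpos [Hrefl [Htri Hsep]]] [Hs [_ [f [g [gf [fg [cf cg]]]]]]]]]].
  exists (fun x x' => d (f x) (f x')). split; [|split].
  - split; [|split; [|split]]; auto.
    intros x y H1 H2. rewrite <- (gf x), <- (gf y). f_equal. auto.
  - intros s Hc. destruct (Hs (fun n => f (s n)) Hc) as [y Hy].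
    exists (g y). intros U HU Ugy.
    destruct (Hy (fun z => U (g z))) as [N HN].
    + intros z Uz. destruct (HU _ Uz) as [e [e0 He]]. exists e. split; [exact e0|].
      intros w Hw. apply He. unfold dsym in *. rewrite !fg. exact Hw.
    + exact Ugy.
    + exists N. intros n Hn. rewrite <- (gf (s n)). apply HN, Hn.
  - intros U. split.
    + intros OU x Ux. destruct (cg U OU (f x)) as [e [e0 He]]; [rewrite gf; exact Ux|].
      exists e. split; [exact e0|]. intros y Hy. rewrite <- (gf y). apply He, Hy.
    + intros HU.
      replace U with (fun x => U (g (f x)))
        by (apply pred_ext; intros x; rewrite gf; tauto).
      apply (cf (fun y => U (g y))).
      intros z Uz. destruct (HU _ Uz) as [e [e0 He]]. exists e. split; [exact e0|].
      intros w Hw. apply He. rewrite !fg. exact Hw.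
Qed.

Lemma small_inv (e : R) : 0 < e -> exists N, forall n, (N <= n)%nat -> / INR (S n) < e.
Proof.
  intros He. destruct (archimed_cor1 e He) as [N [HN N0]]. exists N. intros n Hn.
  apply Rlt_trans with (/ INR N); [|exact HN].
  apply Rinv_lt_contravar; [|apply lt_INR; lia].
  apply Rmult_lt_0_compat; apply lt_0_INR; lia.
Qed.

Lemma inv_INR_S_pos (n : nat) : 0 < / INR (S n).
Proof. apply Rinv_0_lt_compat, lt_0_INR. lia. Qed.

(* Alpha answers with a ball around x_n whose closed version lies in V_n:
   the limit of (x_n) then stays inside every V_n. *)
Lemma quasi_Polish_convergence_Choquet {X : Type} (O : (X -> Prop) -> Prop) :
  quasi_Polish O -> convergence_Choquet_complete O.
Proof.
  intros HQ. destruct (quasi_Polish_metrization O HQ) as [d [Hd [Hs HO]]].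
  pose proof Hd as [Hpos [Hrefl [Htri Hsep]]].
  unfold convergence_Choquet_complete.
  apply (stateful_strategy (nat * (X -> Prop)) (0%nat, fun _ => True) (fun _ => True) snd
    (fun t x V t' => fst t' = S (fst t) /\ exists e, 0 < e < / INR (S (fst t)) /\
        (forall y, d x y <= e -> V y) /\ forall y, snd t' y <-> d x y < e)).
  - exact I.
  - intros x. exact I.
  - intros [n U] x V _ OV Vx _.
    destruct (proj1 (HO V) OV x Vx) as [e [e0 He]].
    pose proof (inv_INR_S_pos n) as Hn.
    (* Halving makes both bounds strict: the closed ball of radius [e'] stays inside the open ball
       of radius [e], and [e'] is below [/ INR (S n)]. *)
    pose (e' := Rmin (e / 2) (/ INR (S n) / 2)).
    assert (He' : 0 < e') by (apply Rmin_pos; lra).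
    pose proof (Rmin_l (e / 2) (/ INR (S n) / 2)) as Hl.
    pose proof (Rmin_r (e / 2) (/ INR (S n) / 2)) as Hr. fold e' in Hl, Hr.
    exists (S n, fun y => d x y < e'). unfold good_step; simpl fst; simpl snd.
    split; [|split; [exact I|split; [|split]]].
    + split; [reflexivity|]. exists e'. split; [lra|]. split; [|tauto].
      intros y Hy. apply He. lra.
    + apply HO, ball_is_open, Hd.
    + rewrite Hrefl. exact He'.
    + intros y Hy. apply He. lra.
  - intros x V t Ht0 HV Hn.
    assert (Hfst : forall n, fst (t n) = n).
    { induction n as [|n IH]; [rewrite Ht0; reflexivity|].
      destruct (Hn n) as [[H _] _]. rewrite H, IH. reflexivity. }
    destruct (choice (fun n e => 0 < e < / INR (S n) /\
        (forall y, d (x n) y <= e -> V n y) /\ forall y, snd (t (S n)) y <-> d (x n) y < e))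
      as [e He].
    { intros n. destruct (Hn n) as [[_ H] _]. rewrite Hfst in H. exact H. }
    assert (Hnest : forall m n, (m <= n)%nat -> subset (snd (t n)) (snd (t m))).
    { apply nested_nat. intros n y Hy. apply (HV n), (Hn n), Hy. }
    (* Later points lie in alpha's earlier answers, which are balls around the earlier points. *)
    assert (Hxx : forall m n, (m <= n)%nat -> d (x m) (x n) < e m).
    { intros m n Hmn. destruct (He m) as [[e0 _] [_ Hout]].
      destruct (Nat.eq_dec m n) as [<-|Hne]; [rewrite Hrefl; exact e0|].
      apply Hout. apply (Hnest (S m) n); [lia|]. apply HV, HV. }
    destruct (Hs x) as [z Hz].
    { intros eps Heps. destruct (small_inv eps Heps) as [N HN]. exists N. intros m n Hm Hmn.
      pose proof (HN m Hm). pose proof (He m) as [He' _]. pose proof (Hxx m n Hmn). lra. }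
    assert (Hlim : forall r, 0 < r -> exists N, forall n, (N <= n)%nat ->
              d z (x n) < r /\ d (x n) z < r).
    { intros r r0. destruct (Hz (fun y => dsym d z y < r)) as [N HN].
      - apply ball_is_open, dsym_quasi_metric, Hd.
      - rewrite (proj1 (proj2 (dsym_quasi_metric d Hd))). exact r0.
      - exists N. intros n Hn'. pose proof (HN n Hn') as H. unfold dsym in H.
        pose proof (Rmax_l (d z (x n)) (d (x n) z)).
        pose proof (Rmax_r (d z (x n)) (d (x n) z)). lra. }
    exists z. split.
    + intros n. split; [apply (Hn n)|].
      (* It suffices that [z] lies in the closed ball around [x (S n)]; otherwise the excess of the
         distance over [e (S n)] is a positive margin that contradicts convergence to [z]. *)
      apply (proj2 (HV (S n))). apply (He (S n)). apply Rnot_lt_le. intros Hlt.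
      destruct (Hlim (d (x (S n)) z - e (S n))) as [N HN]; [lra|].
      destruct (HN (max N (S n))) as [_ HN']; [lia|].
      pose proof (Hxx (S n) (max N (S n)) ltac:(lia)).
      pose proof (Htri (x (S n)) (x (max N (S n))) z). lra.
    + intros W OW Wz. destruct (proj1 (HO W) OW z Wz) as [r [r0 Hr]].
      destruct (Hlim (r / 2)) as [N HN]; [lra|].
      destruct (small_inv (r / 2)) as [M HM]; [lra|].
      exists (max N M). intros y Hy.
      apply (He (max N M)) in Hy. apply Hr.
      pose proof (proj1 (He (max N M))). pose proof (HM (max N M) ltac:(lia)).
      pose proof (HN (max N M) ltac:(lia)).
      pose proof (Htri z (x (max N M)) y). lra.
Qed.

(** The compact set is the saturation of the limit point: it lies in every open set containing that
    point, so one member of a cover suffices. *)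
Lemma convergence_compactly_Choquet {X : Type} (O : (X -> Prop) -> Prop) :
  convergence_Choquet_complete O -> compactly_Choquet_complete O.
Proof.
  intros [sigma Hs]. exists sigma. intros x V. destruct (Hs x V) as [H1 H2].
  split; [exact H1|]. intros Hb. destruct (H2 Hb) as [z [Hz Hbase]].
  exists (fun y => forall W, O W -> W z -> W y). split; [|split; [|split; [|split]]].
  - exists z. auto.
  - intros F HF Hcov. destruct (Hcov z) as [U [FU Uz]]; [auto|].
    exists (U :: nil). split.
    + intros U' [<-|[]]. exact FU.
    + intros y Hy. exists U. split; [left; reflexivity|]. apply Hy; auto.
  - intros y Hy W OW Wz. apply Hy; [exact OW|]. intros w Hw. apply Hw; assumption.
  - intros n. destruct (Hz n) as [HO' Hn]. split; [exact HO'|]. intros y Hy. apply Hy; assumption.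
  - intros W OW HW. apply Hbase; [exact OW|]. apply HW. auto.
Qed.

(** * Domain-complete spaces are LCS-complete *)

Section ContinuousDcpo.
Context {D : Type} {le : D -> D -> Prop}.
Hypothesis Hcont : is_continuous_dcpo le.

Let le_refl : forall x, le x x := proj1 (proj1 (proj1 Hcont)).
Let le_trans : forall x y z, le x y -> le y z -> le x z := proj1 (proj2 (proj1 (proj1 Hcont))).
Let le_antisym : forall x y, le x y -> le y x -> x = y := proj2 (proj2 (proj1 (proj1 Hcont))).
Let wb_directed x : directed le (fun y => way_below le y x) := proj1 (proj2 Hcont x).
Let wb_sup x : is_sup le (fun y => way_below le y x) x := proj2 (proj2 Hcont x).

Lemma way_below_le x y : way_below le x y -> le x y.
Proof. exact (proj1 (wb_sup y) x). Qed.

Lemma way_below_le_trans x y z : way_below le x y -> le y z -> way_below le x z.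
Proof. intros H Hyz A s HA Hs Hz. apply (H A s); eauto. Qed.

Lemma le_way_below_trans x y z : le x y -> way_below le y z -> way_below le x z.
Proof.
  intros Hxy H A s HA Hs Hz. destruct (H A s HA Hs Hz) as [a [Aa Ha]]. exists a. eauto.
Qed.

(** The elements [a] with [a] way below some [z] way below [y] form a directed set with supremum
    [y], so [x] lies below one of them. *)
Lemma way_below_interpolation x y :
  way_below le x y -> exists z, way_below le x z /\ way_below le z y.
Proof.
  intros Hxy.
  destruct (Hxy (fun a => exists z, way_below le a z /\ way_below le z y) y)
    as [a [[z [Haz Hzy]] Hxa]].
  - split.
    + destruct (proj1 (wb_directed y)) as [z Hz].
      destruct (proj1 (wb_directed z)) as [a Ha]. exists a, z. auto.
    + intros a b [z [Haz Hzy]] [w [Hbw Hwy]].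
      destruct (proj2 (wb_directed y) z w Hzy Hwy) as [v [Hv [Hzv Hwv]]].
      destruct (proj2 (wb_directed v) a b) as [c [Hc [Hac Hbc]]];
        [eapply way_below_le_trans; eauto..|].
      exists c. split; [exists v; auto|auto].
  - split.
    + intros a [z [Haz Hzy]]. eapply le_trans; apply way_below_le; eauto.
    + intros u Hu. apply (proj2 (wb_sup y)). intros z Hz.
      apply (proj2 (wb_sup z)). intros a Ha. apply Hu. exists z. auto.
  - apply le_refl.
  - exists z. split; [|exact Hzy]. eapply le_way_below_trans; eauto.
Qed.

Lemma way_above_scott_open x : scott_open le (way_below le x).
Proof.
  split; [intros y z; apply way_below_le_trans|].
  intros A s HA Hs Hx. destruct (way_below_interpolation x s Hx) as [z [Hxz Hzs]].
  destruct (Hzs A s HA Hs (le_refl s)) as [a [Aa Hza]].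
  exists a. split; [exact Aa|]. eapply way_below_le_trans; eauto.
Qed.

Lemma scott_open_way_below U x : scott_open le U -> U x -> exists y, way_below le y x /\ U y.
Proof. intros [_ HU] Ux. exact (HU _ x (wb_directed x) (wb_sup x) Ux). Qed.

Lemma scott_open_not_below x : scott_open le (fun y => ~ le y x).
Proof.
  split.
  - intros y z Hy Hyz Hz. apply Hy. eauto.
  - intros A s _ Hs Hsx. apply NNPP. intros Hno. apply Hsx, (proj2 Hs).
    intros a Aa. apply NNPP. intros Ha. apply Hno. exists a. auto.
Qed.

Lemma scott_closed_down C x y : closed (scott_open le) C -> C x -> le y x -> C y.
Proof.
  intros [Hup _] Cx Hyx. apply NNPP. intros Cy. exact (Hup y x Cy Hyx Cx).
Qed.

Lemma scott_closed_sup C A s :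
  closed (scott_open le) C -> directed le A -> is_sup le A s -> subset A C -> C s.
Proof.
  intros [_ HC] HA Hs HAC. apply NNPP. intros Cs.
  destruct (HC A s HA Hs Cs) as [a [Aa Ca]]. exact (Ca (HAC a Aa)).
Qed.

Lemma scott_topology : is_topology (scott_open le).
Proof.
  split; [|split].
  - split; [auto|]. intros A s [[a Aa] _] _ _. exists a. auto.
  - intros U V [U1 U2] [V1 V2]. split.
    + intros x y [Ux Vx] Hxy. eauto.
    + intros A s HA Hs [Us Vs].
      destruct (U2 A s HA Hs Us) as [a [Aa Ua]]. destruct (V2 A s HA Hs Vs) as [b [Ab Vb]].
      destruct (proj2 HA a b Aa Ab) as [c [Ac [Hac Hbc]]]. exists c. eauto.
  - intros F HF. split.
    + intros x y [U [FU Ux]] Hxy. exists U. split; [exact FU|].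
      exact (proj1 (HF U FU) x y Ux Hxy).
    + intros A s HA Hs [U [FU Us]].
      destruct (proj2 (HF U FU) A s HA Hs Us) as [a [Aa Ua]]. exists a. eauto.
Qed.

(** For [y] way below [x] in [U], the up-set of [y] is compact, since any open set containing [y]
    contains it, and it contains the open set of points way above [y]. *)
Lemma continuous_dcpo_locally_compact : locally_compact (scott_open le).
Proof.
  intros x U HU Ux. destruct (scott_open_way_below U x HU Ux) as [y [Hyx Uy]].
  exists (le y). split; [|split; [|split]].
  - intros F HF Hcov. destruct (Hcov y (le_refl y)) as [W [FW Wy]].
    exists (W :: nil). split; [intros W' [<-|[]]; exact FW|].
    intros z Hz. exists W. split; [left; reflexivity|].
    exact (proj1 (HF W FW) y z Wy Hz).
  - intros z Hz. apply NNPP. intros Hyz.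
    apply (Hz (fun w => ~ le w z)); [apply scott_open_not_below| |apply le_refl].
    intros w Hyw Hwz. apply Hyz. eauto.
  - exists (way_below le y). split; [apply way_above_scott_open|]. split; [exact Hyx|].
    intros z. apply way_below_le.
  - intros z Hz. exact (proj1 HU y z Uy Hz).
Qed.

Lemma scott_point_closure x y : point_closure (scott_open le) x y <-> le y x.
Proof.
  split.
  - intros H. apply (H (fun z => le z x)); [apply scott_open_not_below|apply le_refl].
  - intros Hyx C HC Cx. exact (scott_closed_down C x y HC Cx Hyx).
Qed.

(* The generic point of an irreducible closed set C is the supremum of the
   elements way below some element of C. *)
Lemma continuous_dcpo_sober : sober (scott_open le).
Proof.
  intros C [HC [[c0 Cc0] Hirr]].
  pose (A := fun y => exists c, C c /\ way_below le y c).
  assert (HA : directed le A).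
  { split.
    - destruct (proj1 (wb_directed c0)) as [y Hy]. exists y, c0. auto.
    - intros a b [c [Cc Hac]] [c' [Cc' Hbc']].
      (* The sets way above [a] and way above [b] are open and both meet [C]; irreducibility makes
         them meet at a common point of [C]. *)
      assert (Hcom : exists w, C w /\ way_below le a w /\ way_below le b w).
      { apply NNPP. intros Hno.
        destruct (Hirr (fun w => ~ way_below le a w) (fun w => ~ way_below le b w))
          as [H|H].
        - unfold closed. replace (fun w => ~ ~ way_below le a w) with (way_below le a)
            by (apply pred_ext; intros w; split; [tauto|apply NNPP]).
          apply way_above_scott_open.
        - unfold closed. replace (fun w => ~ ~ way_below le b w) with (way_below le b)
            by (apply pred_ext; intros w; split; [tauto|apply NNPP]).
          apply way_above_scott_open.
        - intros w Cw. apply NNPP. intros Hw. apply Hno. exists w. tauto.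
        - exact (H c Cc Hac).
        - exact (H c' Cc' Hbc'). }
      destruct Hcom as [w [Cw [Haw Hbw]]].
      destruct (proj2 (wb_directed w) a b Haw Hbw) as [v [Hv Hab]].
      exists v. split; [exists w; auto|exact Hab]. }
  destruct (proj2 (proj1 Hcont) A HA) as [x Hx].
  assert (Cx : C x).
  { apply (scott_closed_sup C A x HC HA Hx). intros y [c [Cc Hyc]].
    exact (scott_closed_down C c y HC Cc (way_below_le y c Hyc)). }
  assert (HCx : forall y, C y <-> le y x).
  { intros y. split.
    - intros Cy. apply (proj2 (wb_sup y)). intros z Hz. apply (proj1 Hx). exists y. auto.
    - exact (scott_closed_down C x y HC Cx). }
  exists x. split.
  - intros y. rewrite scott_point_closure. apply HCx.
  - intros x' Hx'. apply le_antisym.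
    + apply HCx, Hx', scott_point_closure, le_refl.
    + apply scott_point_closure, Hx', Cx.
Qed.

End ContinuousDcpo.

Lemma domain_complete_LCS_complete {X : Type} (O : (X -> Prop) -> Prop) :
  domain_complete O -> LCS_complete O.
Proof.
  intros [D [le [Hc HS]]]. exists D, (scott_open le).
  split; [apply scott_topology|].
  split; [apply continuous_dcpo_locally_compact, Hc|].
  split; [apply continuous_dcpo_sober, Hc|exact HS].
Qed.

(** * LCS-complete spaces are compactly Choquet-complete *)

Section WellFiltered.
Context {Y : Type} {OY : (Y -> Prop) -> Prop}.
Hypothesis Htop : is_topology OY.

(** A finite subcover by sets [A] united with [W] has a largest member because [F] is a chain; the
    first alternative arises when the subcover uses only [W]. *)
Lemma compact_chain_cover (Q : Y -> Prop) (F : (Y -> Prop) -> Prop) (W : Y -> Prop) :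
  compact OY Q -> (forall A, F A -> OY (fun y => A y \/ W y)) -> OY W ->
  (forall A B, F A -> F B -> subset A B \/ subset B A) ->
  (forall y, Q y -> (exists A, F A /\ A y) \/ W y) ->
  subset Q W \/ exists A, F A /\ forall y, Q y -> A y \/ W y.
Proof.
  intros HQ HF OW Hchain Hcov.
  destruct (HQ (fun G => G = W \/ exists A, F A /\ G = fun y => A y \/ W y)) as [l [Hl Hlcov]].
  - intros G [->|[A [FA ->]]]; auto.
  - intros y Qy. destruct (Hcov y Qy) as [[A [FA Ay]]|Wy].
    + exists (fun y => A y \/ W y). split; [right; exists A; auto|left; exact Ay].
    + exists W. auto.
  - assert (Hmax : (forall G, In G l -> subset G W) \/
              exists A, F A /\ forall G, In G l -> forall y, G y -> A y \/ W y).
    { clear Hlcov. induction l as [|G l IH].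
      - left. intros G [].
      - destruct IH as [IH|[A [FA IH]]]; [intros U HU; apply Hl; right; exact HU| |].
        + destruct (Hl G (or_introl eq_refl)) as [->|[B [FB ->]]].
          * left. intros G [<-|HG]; [intros y Hy; exact Hy|auto].
          * right. exists B. split; [exact FB|].
            intros G [<-|HG] y Gy; [exact Gy|right; exact (IH G HG y Gy)].
        + right. destruct (Hl G (or_introl eq_refl)) as [->|[B [FB ->]]].
          * exists A. split; [exact FA|]. intros G [<-|HG] y Gy; [auto|exact (IH G HG y Gy)].
          * destruct (Hchain A B FA FB) as [HAB|HBA].
            -- exists B. split; [exact FB|]. intros G [<-|HG] y Gy; [exact Gy|].
               destruct (IH G HG y Gy) as [Ay|Wy]; auto.
            -- exists A. split; [exact FA|]. intros G [<-|HG] y Gy; [|exact (IH G HG y Gy)].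
               destruct Gy as [By|Wy]; auto. }
    destruct Hmax as [H|[A [FA H]]].
    + left. intros y Qy. destruct (Hlcov y Qy) as [G [HG Gy]]. exact (H G HG y Gy).
    + right. exists A. split; [exact FA|]. intros y Qy.
      destruct (Hlcov y Qy) as [G [HG Gy]]. exact (H G HG y Gy).
Qed.

(* Otherwise Zorn's lemma gives a maximal open M containing W and no Q n; its
   complement is irreducible, and its generic point lies in every Q n. *)
Lemma sober_well_filtered (Q : nat -> Y -> Prop) (W : Y -> Prop) :
  sober OY -> (forall n, compact OY (Q n)) -> (forall n, saturated OY (Q n)) ->
  (forall n, subset (Q (S n)) (Q n)) -> OY W ->
  (forall y, (forall n, Q n y) -> W y) -> exists n, subset (Q n) W.
Proof.
  intros Hsob Hcomp Hsat Hdec OW Hsub. apply NNPP. intros Hno.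
  (* Adjoining [W] inside [P], instead of asking that [A] contain it, lets the empty union of the
     empty chain satisfy [P]. *)
  pose (P := fun A : Y -> Prop =>
    OY (fun y => A y \/ W y) /\ forall n, ~ subset (Q n) (fun y => A y \/ W y)).
  destruct (@classical_sets.Zorn_bigcup Y P) as [M0 [[OM HM] Hmax]].
  { intros F HF Hchain. split.
    - apply (open_of_nbhds Htop). intros y [[A FA Ay]|Wy].
      + exists (fun y => A y \/ W y). split; [apply (HF A FA)|]. split; [left; exact Ay|].
        intros z [Az|Wz]; [left; exists A; assumption|right; exact Wz].
      + exists W. split; [exact OW|]. split; [exact Wy|]. intros z Wz. right. exact Wz.
    - intros n Hn.
      destruct (compact_chain_cover (Q n) F W) as [H|[A [FA H]]].
      + apply Hcomp.
      + intros A FA. apply (HF A FA).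
      + exact OW.
      + exact Hchain.
      + intros y Qy. destruct (Hn y Qy) as [[A FA Ay]|Wy]; [left; exists A; auto|auto].
      + apply Hno. exists n. exact H.
      + exact (proj2 (HF A FA) n H). }
  set (M := fun y => M0 y \/ W y) in *.
  assert (Hbig : forall G, OY G -> ~ subset G M ->
            exists n, subset (Q n) (fun y => M y \/ G y)).
  { intros G OG HG. apply NNPP. intros HnG.
    assert (Heq : (fun y => (M0 y \/ G y) \/ W y) = (fun y => M y \/ G y))
      by (apply pred_ext; intros y; unfold M; tauto).
    apply (Hmax (fun y => M0 y \/ G y)).
    - split; [intros y Hy; left; exact Hy|]. intros H. apply HG. intros y Gy.
      left. apply H. right. exact Gy.
    - split; rewrite Heq; [apply (open_union Htop); assumption|].
      intros n Hn. apply HnG. exists n. exact Hn. }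
  pose proof (nested_nat Q Hdec) as Hnest.
  destruct (Hsob (fun y => ~ M y)) as [x [Hx _]].
  { split; [|split].
    - unfold closed. replace (fun y => ~ ~ M y) with M; [exact OM|].
      apply pred_ext. intros y. split; [tauto|apply NNPP].
    - apply NNPP. intros Hn. apply (HM 0%nat). intros y _. apply NNPP. intros Hy.
      apply Hn. exists y. exact Hy.
    - intros A B HA HB HAB.
      destruct (classic (subset (fun y => ~ A y) M)) as [HAM|HAM];
        [left; intros y Hy; apply NNPP; intros Ay; exact (Hy (HAM y Ay))|].
      destruct (classic (subset (fun y => ~ B y) M)) as [HBM|HBM];
        [right; intros y Hy; apply NNPP; intros By; exact (Hy (HBM y By))|].
      (* Both enlargements of [M] contain [Q (max n m)]; as [A] and [B] cover the complement of [M],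
         this set would lie in [M]. *)
      destruct (Hbig _ HA HAM) as [n Hn]. destruct (Hbig _ HB HBM) as [m Hm].
      exfalso. apply (HM (max n m)). intros y Qy.
      pose proof (Hn y (Hnest n (max n m) ltac:(lia) y Qy)).
      pose proof (Hm y (Hnest m (max n m) ltac:(lia) y Qy)).
      apply NNPP. intros My. pose proof (HAB y My). cbv beta in *. tauto. }
  assert (Mx : ~ M x) by (apply Hx; intros A _ Ax; exact Ax).
  (* If an open [U] containing [Q n] missed [x], the complement of [U] would contain the closure of
     [x], the complement of [M], forcing [Q n] into [M]. *)
  apply Mx. right. apply Hsub. intros n. apply Hsat. intros U OU HQU.
  apply NNPP. intros Ux. apply (HM n). intros y Qy. apply NNPP. intros My.
  fold (M y) in My. apply Hx in My. apply (My (fun z => ~ U z)); [|exact Ux|apply HQU, Qy].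
  unfold closed. replace (fun z => ~ ~ U z) with U; [exact OU|].
  apply pred_ext. intros z. split; [tauto|apply NNPP].
Qed.

End WellFiltered.

Lemma homeomorphic_subspace_embedding {X Y : Type} (O : (X -> Prop) -> Prop)
    (OY : (Y -> Prop) -> Prop) (S : Y -> Prop) :
  homeomorphic O (subspace OY S) -> exists f : X -> Y,
    (forall x, S (f x)) /\ (forall y, S y -> exists x, f x = y) /\
    (forall V, OY V -> O (fun x => V (f x))) /\
    (forall U, O U -> exists V, OY V /\ forall x, U x <-> V (f x)).
Proof.
  intros [f [g [gf [fg [cf cg]]]]]. exists (fun x => proj1_sig (f x)).
  split; [|split; [|split]].
  - intros x. exact (proj2_sig (f x)).
  - intros y Sy. exists (g (exist _ y Sy)). rewrite fg. reflexivity.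
  - intros V OV. apply (cf (fun p => V (proj1_sig p))). exists V. split; [exact OV|tauto].
  - intros U OU. destruct (cg U OU) as [V [OV HV]]. exists V. split; [exact OV|].
    intros x. rewrite <- HV, gf. tauto.
Qed.

(** Alpha's memory: [trace] is an open set of [Y] whose preimage in [X] is the answer, and [hull] a
    compact saturated set containing it; the initial [hull] is a dummy. *)
Record LCS_state (Y : Type) := LCSState {
  round : nat; trace : Y -> Prop; hull : Y -> Prop }.

(* Alpha answers with the trace on X of an open G of Y enclosed in a compact
   saturated Q that refines the previous move and the n-th open set of the
   G_delta presentation. *)
Lemma LCS_compactly_Choquet {X : Type} (O : (X -> Prop) -> Prop) :
  LCS_complete O -> compactly_Choquet_complete O.
Proof.
  intros [Y [OY [Htop [Hlc [Hsob [S [[U [HU HSU]] Hhom]]]]]]].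
  destruct (homeomorphic_subspace_embedding O OY S Hhom) as [f [Sf [fS [cf ef]]]].
  unfold compactly_Choquet_complete.
  apply (stateful_strategy (LCS_state Y) (LCSState Y 0 (fun _ => True) (fun _ => True))
    (fun t => OY (trace Y t)) (fun t x => trace Y t (f x))
    (fun t x V t' => round Y t' = Datatypes.S (round Y t) /\
       compact OY (hull Y t') /\ saturated OY (hull Y t') /\
       subset (trace Y t') (hull Y t') /\ subset (hull Y t') (trace Y t) /\
       subset (hull Y t') (U (round Y t)))).
  - apply (open_full Htop).
  - intros x. exact I.
  - intros [n G Q] x V OG OV Vx HVG. simpl in OG, HVG.
    destruct (ef V OV) as [V' [OV' HV']].
    destruct (Hlc (f x) (fun y => V' y /\ (G y /\ U n y))) as [Q' [HQ' [HsQ' [[G' [OG' [G'x HG']]] HQsub]]]].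
    + apply (open_inter Htop); [exact OV'|]. apply (open_inter Htop); [exact OG|apply HU].
    + split; [apply HV', Vx|]. split; [apply HVG, Vx|]. apply HSU, Sf.
    + exists (LCSState Y (Datatypes.S n) G' Q'). unfold good_step; simpl.
      split; [|split; [exact OG'|split; [apply cf, OG'|split; [exact G'x|]]]].
      * split; [reflexivity|]. split; [exact HQ'|]. split; [exact HsQ'|].
        split; [exact HG'|]. split; intros y Qy; apply HQsub, Qy.
      * intros y Gy. apply HV'. apply HQsub, HG', Gy.
  - intros x V t Ht0 HV Hn.
    assert (Hround : forall n, round Y (t n) = n).
    { induction n as [|n IH]; [rewrite Ht0; reflexivity|].
      destruct (Hn n) as [[H _] _]. rewrite H, IH. reflexivity. }
    pose (Q := fun n => hull Y (t (Datatypes.S n))).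
    assert (HQS : forall y, (forall n, Q n y) -> S y).
    { intros y Qy. apply HSU. intros n. destruct (Hn n) as [[_ [_ [_ [_ [_ H]]]]] _].
      rewrite Hround in H. apply H, Qy. }
    (* The hulls decrease, so well-filteredness applies to them. *)
    assert (Hwf : forall W, OY W -> (forall y, (forall n, Q n y) -> W y) ->
              exists n, subset (Q n) W).
    { intros W OW HW. apply (sober_well_filtered Htop Q W Hsob); auto.
      - intros n. apply (Hn n).
      - intros n. apply (Hn n).
      - intros n y Qy. apply (Hn n). apply (Hn (Datatypes.S n)), Qy. }
    exists (fun x => forall n, Q n (f x)). split; [|split; [|split; [|split]]].
    + apply NNPP. intros Hemp.
      destruct (Hwf (fun _ => False)) as [n Hfalse].
      (* The empty set is open as the union of the empty family. *)
      * replace (fun _ : Y => False) with (fun y : Y => exists A : Y -> Prop, False /\ A y).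
        -- apply Htop. intros A [].
        -- apply pred_ext. intros y. split; [intros [A [[] _]]|intros []].
      * intros y Qy. apply Hemp. destruct (fS y (HQS y Qy)) as [z <-]. exists z. exact Qy.
      * apply (Hfalse (f (x n))). apply (Hn n). apply (Hn n).
    + intros F HF Hcov.
      (* The cover is lifted to [Y]; its union contains a whole hull [Q n], whose compactness gives
         the finite subcover. *)
      destruct (Hwf (fun y => exists A, (OY A /\ F (fun x => A (f x))) /\ A y)) as [n Hn'].
      * apply Htop. intros A [OA _]. exact OA.
      * intros y Qy. destruct (fS y (HQS y Qy)) as [z <-].
        destruct (Hcov z Qy) as [A [FA Az]]. destruct (ef A (HF A FA)) as [A' [OA' HA']].
        exists A'. split; [split; [exact OA'|]|apply HA', Az].
        replace (fun x => A' (f x)) with A; [exact FA|]. apply pred_ext, HA'.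
      * destruct (proj1 (proj2 (proj1 (Hn n))) (fun A => OY A /\ F (fun x => A (f x))))
          as [l [Hl Hlcov]].
        -- intros A [OA _]. exact OA.
        -- exact Hn'.
        -- exists (map (fun A x => A (f x)) l). split.
           ++ intros A HA. apply in_map_iff in HA. destruct HA as [A' [<- HA']].
              apply Hl, HA'.
           ++ intros z Qz. destruct (Hlcov (f z) (Qz n)) as [A [HA Az]].
              exists (fun x => A (f x)). split; [|exact Az].
              apply (in_map (fun (A : Y -> Prop) x => A (f x))), HA.
    + intros z Hz n. apply (Hn n). apply Hz; [apply (Hn n)|].
      intros w Qw. apply (Hn (Datatypes.S n)), Qw.
    + intros n. split; [apply (Hn n)|]. intros z Qz. apply (Hn (Datatypes.S n)), Qz.
    + intros W OW HW. destruct (ef W OW) as [W' [OW' HW']].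
      destruct (Hwf W' OW') as [n Hn'].
      * intros y Qy. destruct (fS y (HQS y Qy)) as [z <-]. apply HW', HW, Qy.
      * exists n. intros z Gz. apply HW', Hn'. apply (Hn n), Gz.
Qed.

(** * Countable presentations *)

Definition enumerable (T : Type) : Prop := exists e : nat -> T, forall t, exists n, e n = t.

Lemma enumerable_prod (S T : Type) : enumerable S -> enumerable T -> enumerable (S * T).
Proof.
  intros [e He] [e' He']. exists (fun n => (e (fst (of_nat n)), e' (snd (of_nat n)))).
  intros [s t]. destruct (He s) as [a <-]. destruct (He' t) as [b <-].
  exists (to_nat (a, b)). rewrite cancel_of_to. reflexivity.
Qed.

Lemma enumerable_sum (S T : Type) : enumerable S -> enumerable T -> enumerable (S + T).
Proof.
  intros [e He] [e' He'].
  exists (fun n => match fst (of_nat n) with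
                   | 0%nat => inl (e (snd (of_nat n)))
                   | _ => inr (e' (snd (of_nat n))) end).
  intros [s|t].
  - destruct (He s) as [a <-]. exists (to_nat (0%nat, a)). rewrite cancel_of_to. reflexivity.
  - destruct (He' t) as [a <-]. exists (to_nat (1%nat, a)). rewrite cancel_of_to. reflexivity.
Qed.

Lemma enumerable_nat : enumerable nat.
Proof. exists (fun n => n). intros n. exists n. reflexivity. Qed.

Lemma enumerable_list (T : Type) : enumerable T -> enumerable (list T).
Proof.
  intros [e He].
  pose (dec := fix dec (k n : nat) : list T :=
    match k with
    | 0%nat => nil
    | S k => e (fst (of_nat n)) :: dec k (snd (of_nat n))
    end).
  exists (fun n => dec (fst (of_nat n)) (snd (of_nat n))).
  assert (H : forall l, exists n, dec (length l) n = l).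
  { induction l as [|a l [n IH]]; [exists 0%nat; reflexivity|].
    destruct (He a) as [b <-]. exists (to_nat (b, n)).
    change (e (fst (of_nat (to_nat (b, n)))) :: dec (length l) (snd (of_nat (to_nat (b, n))))
            = e b :: l).
    rewrite cancel_of_to. f_equal. exact IH. }
  intros l. destruct (H l) as [n Hn]. exists (to_nat (length l, n)).
  rewrite cancel_of_to. exact Hn.
Qed.

Definition is_base {X : Type} (O : (X -> Prop) -> Prop) (B : nat -> X -> Prop) : Prop :=
  (forall n, O (B n)) /\
  forall U, O U -> forall x, U x -> exists n, B n x /\ subset (B n) U.

(* A set A of indices is a model if every axiom "if all of F n is in A then
   some element of W n is in A" holds; B presents X when the models are exactly
   the sets {i | x in B i} for points x. *)
Definition is_model (F : nat -> list nat) (W : nat -> nat -> Prop) (A : nat -> Prop) : Prop :=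
  forall n, (forall i, In i (F n) -> A i) -> exists j, W n j /\ A j.

Definition presents {X : Type} (B : nat -> X -> Prop) (F : nat -> list nat)
  (W : nat -> nat -> Prop) : Prop :=
  (forall x, is_model F W (fun i => B i x)) /\
  (forall A, is_model F W A -> exists x, forall i, A i <-> B i x).

Definition presentable {X : Type} (O : (X -> Prop) -> Prop) : Prop :=
  exists B F W, is_base O B /\ presents B F W.

(** * The countable tree of plays and its axioms *)

Section GameTree.
Context {X : Type} {O : (X -> Prop) -> Prop}.
Hypothesis Htop : is_topology O.
Variables (B : nat -> X -> Prop) (sigma : list (X * (X -> Prop)) -> (X -> Prop)).
Hypothesis HB : is_base O B.
Hypothesis Hsigma : alpha_winning O (nbhd_base_of_compact O) sigma.
Hypothesis inh : inhabited X.

Definition position (h : list (X * (X -> Prop))) : X -> Prop :=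
  match h with nil => fun _ => True | _ => sigma h end.

(** Histories list the oldest move first, hence the extension at the end. *)
Inductive legal : list (X * (X -> Prop)) -> Prop :=
| legal_nil : legal nil
| legal_snoc h x V : legal h -> O V -> V x -> subset V (position h) ->
    legal (h ++ (x, V) :: nil).

Lemma legal_beta_legal (x : nat -> X) (V : nat -> X -> Prop) h :
  legal h -> h = map (fun i => (x i, V i)) (seq 0 (length h)) ->
  forall k, (k < length h)%nat -> beta_legal O sigma x V k.
Proof.
  induction 1 as [|h y U Hh IH OU Uy HU]; [intros _ k Hk; simpl in Hk; lia|].
  rewrite length_app, Nat.add_comm. simpl length. change (1 + length h)%nat with (S (length h)).
  rewrite history_S. intros Heq k Hk. apply app_inj_tail in Heq. destruct Heq as [Eh Ep].
  destruct (Nat.eq_dec k (length h)) as [->|Hne]; [|apply IH; [exact Eh|lia]].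
  injection Ep as -> ->. split; [exact OU|]. split; [exact Uy|].
  destruct (length h) as [|m]; [exact I|].
  rewrite Eh in HU. exact HU.
Qed.

Lemma legal_answer h x V : legal (h ++ (x, V) :: nil) ->
  let U := sigma (h ++ (x, V) :: nil) in O U /\ U x /\ subset U V.
Proof.
  intros Hl. set (h' := h ++ (x, V) :: nil) in *.
  (* Alpha's legality is stated for infinite sequences of moves, so the finite history is padded
     with its last move. *)
  pose (xs := fun i => fst (nth i h' (x, V))). pose (Vs := fun i => snd (nth i h' (x, V))).
  assert (Hlen : length h' = S (length h)) by (unfold h'; rewrite length_app; simpl; lia).
  assert (Hh' : h' = map (fun i => (xs i, Vs i)) (seq 0 (length h'))).
  { apply nth_ext with (x, V) (xs 0%nat, Vs 0%nat); [rewrite length_map, length_seq; reflexivity|].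
    intros n Hn. rewrite (map_nth (fun i => (xs i, Vs i))), seq_nth by exact Hn.
    apply surjective_pairing. }
  destruct (Hsigma xs Vs) as [Ha _].
  destruct (Ha (length h)) as [H1 [H2 H3]].
  - intros k Hk. apply (legal_beta_legal xs Vs h' Hl Hh'). lia.
  - unfold alpha_move, history in H1, H2, H3. rewrite <- Hlen, <- Hh' in H1, H2, H3.
    unfold xs in H2. unfold Vs in H3.
    unfold h' in H2 at 2, H3 at 2.
    rewrite nth_middle in H2, H3. split; [exact H1|]. split; [exact H2|exact H3].
Qed.

Lemma position_open h : legal h -> O (position h).
Proof.
  intros Hl. destruct Hl as [|h x V Hh OV Vx HV]; [apply (open_full Htop)|].
  pose proof (legal_answer h x V (legal_snoc h x V Hh OV Vx HV)) as [H _].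
  destruct h; exact H.
Qed.

Definition beta_open (h : list (X * (X -> Prop))) (i : nat) : X -> Prop :=
  fun y => position h y /\ B i y.

Definition good_point (h : list (X * (X -> Prop))) (i j : nat) (x : X) : Prop :=
  beta_open h i x /\ subset (B j) (sigma (h ++ (x, beta_open h i) :: nil)).

(* Nodes of a countable tree of plays, last move first: at (i, j) beta cuts the
   current open set down to B i, choosing a point at which alpha's answer
   contains B j. *)
Fixpoint node_history (s : list (nat * nat)) : list (X * (X -> Prop)) :=
  match s with
  | nil => nil
  | (i, j) :: s => node_history s ++
      (epsilon inh (good_point (node_history s) i j), beta_open (node_history s) i) :: nil
  end.

Fixpoint good_node (s : list (nat * nat)) : Prop :=
  match s with
  | nil => True
  | (i, j) :: s => good_node s /\ exists x, good_point (node_history s) i j x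
  end.

Lemma good_node_legal s : good_node s -> legal (node_history s).
Proof.
  induction s as [|[i j] s IH]; [intros _; apply legal_nil|].
  intros [Hs Hx]. apply epsilon_spec with (i := inh) in Hx. destruct Hx as [Hx _].
  simpl. apply legal_snoc; [exact (IH Hs)| |exact Hx|].
  - apply (open_inter Htop); [apply position_open, IH, Hs|apply HB].
  - intros y Hy. apply Hy.
Qed.

(** Alpha's answer to [x] is an open neighbourhood of [x] and so contains a basic [B j] around it.
    The node records only [j] and not [x], which keeps the tree countable. *)
Lemma good_child s i x :
  good_node s -> position (node_history s) x -> B i x ->
  exists j, good_node ((i, j) :: s) /\ B j x.
Proof.
  intros Hs Hx Bx. pose proof (good_node_legal s Hs) as Hl.
  pose proof (legal_answer (node_history s) x (beta_open (node_history s) i)) as Ha.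
  destruct Ha as [OU [Ux _]].
  - apply legal_snoc; [exact Hl| |split; assumption|intros y Hy; apply Hy].
    apply (open_inter Htop); [apply position_open, Hl|apply HB].
  - destruct (proj2 HB _ OU x Ux) as [j [Bj Hj]]. exists j. split; [|exact Bj].
    split; [exact Hs|]. exists x. split; [split; assumption|exact Hj].
Qed.

Definition last_index (s : list (nat * nat)) : list nat :=
  match s with nil => nil | (_, l) :: _ => l :: nil end.

(** The last recorded basic set lies inside alpha's last answer, so membership of a single index
    certifies that a point is still in play. *)
Lemma last_index_position s : good_node s ->
  forall x, (forall l, In l (last_index s) -> B l x) -> position (node_history s) x.
Proof.
  destruct s as [|[i j] s]; [intros _ x _; exact I|].
  intros [_ Hx] x Hl. apply epsilon_spec with (i := inh) in Hx.
  pose proof (proj2 Hx x (Hl j (or_introl eq_refl))) as H. simpl.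
  destruct (node_history s); exact H.
Qed.

(** Three kinds of axioms: some index holds; the play at node [s] can be continued by [i]; a basic
    set is covered by a finite list of basic sets. *)
Definition axiom_index : Type := unit + list (nat * nat) * nat + nat * list nat.

Definition axiom_premise (c : axiom_index) : list nat :=
  match c with
  | inl (inl _) => nil
  | inl (inr (s, i)) => i :: last_index s
  | inr (k, _) => k :: nil
  end.

Definition axiom_conclusion (c : axiom_index) : nat -> Prop :=
  match c with
  | inl (inl _) => fun _ => True
  | inl (inr (s, i)) => fun j => good_node s -> good_node ((i, j) :: s)
  | inr (k, F) => fun j => (forall x, B k x -> exists i, In i F /\ B i x) -> In j F
  end.

Lemma points_satisfy_axioms x c :
  (forall i, In i (axiom_premise c) -> B i x) -> exists j, axiom_conclusion c j /\ B j x.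
Proof.
  destruct c as [[[]|[s i]]|[k F]]; simpl; intros Hp.
  - destruct (proj2 HB _ (open_full Htop) x I) as [j [Bj _]]. exists j. auto.
  - destruct (classic (good_node s)) as [Hs|Hs].
    + destruct (good_child s i x Hs) as [j [Hj Bj]].
      * apply last_index_position; [exact Hs|]. auto.
      * apply Hp. auto.
      * exists j. split; [intros _; exact Hj|exact Bj].
    + exists i. split; [tauto|]. apply Hp. auto.
  - destruct (classic (forall x, B k x -> exists i, In i F /\ B i x)) as [HF|HF].
    + destruct (HF x) as [i [Hi Bi]]; [apply Hp; auto|]. exists i. auto.
    + exists k. split; [tauto|]. apply Hp. auto.
Qed.

Section Branch.
Variable A : nat -> Prop.
Hypothesis HA : forall c, (forall i, In i (axiom_premise c) -> A i) ->
  exists j, axiom_conclusion c j /\ A j.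

Lemma model_good_child s i : good_node s -> (forall l, In l (last_index s) -> A l) -> A i ->
  exists j, A j /\ good_node ((i, j) :: s).
Proof.
  intros Hs Hl Ai. destruct (HA (inl (inr (s, i)))) as [j [Hj Aj]].
  - intros l [<-|Hin]; auto.
  - exists j. split; [exact Aj|exact (Hj Hs)].
Qed.

Lemma model_up_list k F : A k -> (forall x, B k x -> exists i, In i F /\ B i x) ->
  exists i, In i F /\ A i.
Proof.
  intros Ak HF. destruct (HA (inr (k, F))) as [j [Hj Aj]].
  - intros i [<-|[]]. exact Ak.
  - exists j. split; [exact (Hj HF)|exact Aj].
Qed.

(* A branch of the tree along which beta plays every B i with i in A is won by
   alpha; the resulting compact set Q has A as its filter of basic
   neighbourhoods, and this filter is prime, so Q is generated by one point. *)
Lemma model_is_point : exists x, forall i, A i <-> B i x.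
Proof.
  destruct (HA (inl (inl tt))) as [a0 [_ Aa0]]; [intros i []|].
  (* An enumeration of [A] in which each index [i] of [A] is played at round [i]; [a0] fills the
     other rounds. *)
  pose (a := fun n => if excluded_middle_informative (A n) then n else a0).
  assert (Aa : forall n, A (a n)).
  { intros n. unfold a. destruct (excluded_middle_informative (A n)); assumption. }
  pose (j := fun n s => epsilon (inhabits 0%nat) (fun j => A j /\ good_node ((a n, j) :: s))).
  pose (node := fix node n : list (nat * nat) :=
    match n with 0%nat => nil | S n => (a n, j n (node n)) :: node n end).
  assert (Hnode : forall n, good_node (node n) /\ forall l, In l (last_index (node n)) -> A l).
  { induction n as [|n [IH1 IH2]]; [split; [exact I|intros l []]|].
    destruct (epsilon_spec (inhabits 0%nat) (fun j => A j /\ good_node ((a n, j) :: node n)))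
      as [Aj Hj]; [apply model_good_child; auto|].
    split; [exact Hj|]. intros l [<-|[]]. exact Aj. }
  pose (x := fun n => epsilon inh (good_point (node_history (node n)) (a n) (j n (node n)))).
  pose (V := fun n => beta_open (node_history (node n)) (a n)).
  assert (Hhist : forall n, node_history (node n) = map (fun i => (x i, V i)) (seq 0 n)).
  { induction n as [|n IH]; [reflexivity|].
    rewrite history_S, <- IH. reflexivity. }
  assert (Hlen : forall n, length (node_history (node n)) = n).
  { intros n. rewrite Hhist, length_map, length_seq. reflexivity. }
  destruct (Hsigma x V) as [Halpha Hwin].
  assert (Hbeta : forall n, beta_legal O sigma x V n).
  { intros n. apply (legal_beta_legal x V (node_history (node (S n)))).
    - apply good_node_legal, Hnode.
    - rewrite Hlen. apply Hhist.
    - rewrite Hlen. lia. }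
  destruct (Hwin Hbeta) as [Q [[q0 Qq0] [HQ [_ [HQU Hbase]]]]].
  assert (HUa : forall n, subset (alpha_move sigma x V n) (B (a n))).
  { intros n y Hy. apply (Halpha n (fun k _ => Hbeta k)) in Hy. apply Hy. }
  assert (HUj : forall n, exists k, A k /\ subset (B k) (alpha_move sigma x V n)).
  { intros n. destruct (Hnode (S n)) as [Hg Hl]. exists (j n (node n)).
    split; [apply Hl; left; reflexivity|]. intros y By.
    pose proof (last_index_position (node (S n)) Hg y) as Hp.
    rewrite Hhist in Hp. apply Hp. intros l [<-|[]]. exact By. }
  assert (HAQ : forall i, A i -> subset Q (B i)).
  { intros i Ai y Qy. replace i with (a i).
    - apply HUa, HQU, Qy.
    - unfold a. destruct (excluded_middle_informative (A i)); tauto. }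
  (* A finite union of basic sets around [Q] contains an answer of alpha, hence some [B k] with [k]
     in [A]; the covering axiom then puts one of the indices in [A]. *)
  assert (HQA : forall F, (forall y, Q y -> exists i, In i F /\ B i y) -> exists i, In i F /\ A i).
  { intros F HF. destruct (Hbase (fun y => exists i, In i F /\ B i y)) as [n Hn].
    - apply (open_of_nbhds Htop). intros y [i [Hi Bi]]. exists (B i).
      split; [apply HB|]. split; [exact Bi|]. intros z Bz. exists i. auto.
    - exact HF.
    - destruct (HUj n) as [k [Ak Hk]]. apply (model_up_list k F Ak).
      intros y By. apply Hn, Hk, By. }
  apply NNPP. intros Hno.
  (* If no point has neighbourhood filter [A], then each point of [Q] lies in some [B i] with [i]
     outside [A]; a finite subcover contradicts [HQA]. *)
  destruct (HQ (fun U => exists i, ~ A i /\ U = B i)) as [l [Hl Hcov]].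
  - intros U [i [_ ->]]. apply HB.
  - intros y Qy. apply NNPP. intros Hy. apply Hno. exists y. intros i. split.
    + intros Ai. exact (HAQ i Ai y Qy).
    + intros By. apply NNPP. intros Ai. apply Hy. exists (B i). split; [exists i; auto|exact By].
  - assert (HF : exists F, (forall i, In i F -> ~ A i) /\
              forall U, In U l -> exists i, In i F /\ U = B i).
    { clear Hcov. induction l as [|U l IH].
      - exists nil. split; [intros i []|intros U []].
      - destruct IH as [F [HF1 HF2]]; [intros U' HU'; apply Hl; right; exact HU'|].
        destruct (Hl U (or_introl eq_refl)) as [i [Ai ->]]. exists (i :: F). split.
        + intros i' [<-|Hi']; auto.
        + intros U [<-|HU].
          * exists i. split; [left; reflexivity|reflexivity].
          * destruct (HF2 U HU) as [i' [Hi' E]]. exists i'. split; [right; exact Hi'|exact E]. }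
    destruct HF as [F [HF1 HF2]]. destruct (HQA F) as [i [Hi Ai]]; [|exact (HF1 i Hi Ai)].
    intros y Qy. destruct (Hcov y Qy) as [U [HU Uy]]. destruct (HF2 U HU) as [i [Hi ->]].
    exists i. auto.
Qed.

End Branch.

End GameTree.

Lemma compactly_Choquet_presentable {X : Type} (O : (X -> Prop) -> Prop) :
  is_topology O -> countably_based O -> compactly_Choquet_complete O -> presentable O.
Proof.
  intros Htop [B HB] [sigma Hsigma]. exists B.
  destruct (classic (inhabited X)) as [inh|Hempty].
  - assert (He : enumerable axiom_index).
    { repeat (apply enumerable_sum || apply enumerable_prod || apply enumerable_list);
        try apply enumerable_nat.
      exists (fun _ => tt). intros []. exists 0%nat. reflexivity. }
    destruct He as [e He].
    exists (fun n => axiom_premise (e n)), (fun n => axiom_conclusion B sigma inh (e n)).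
    split; [exact HB|split].
    + intros x n. apply (points_satisfy_axioms Htop B sigma HB Hsigma inh).
    + intros A HA. apply (model_is_point Htop B sigma HB Hsigma inh).
      intros c. destruct (He c) as [n <-]. apply HA.
  (* The empty space is presented by an axiom that no set satisfies. *)
  - exists (fun _ => nil), (fun _ _ => False). split; [exact HB|split].
    + intros x. exfalso. apply Hempty. constructor. exact x.
    + intros A HA. destruct (HA 0%nat) as [j [[] _]]. intros i [].
Qed.

(** * Presentable spaces are quasi-Polish *)

Definition eventually (P : nat -> Prop) : Prop := exists N, forall n, (N <= n)%nat -> P n.

Lemma eventually_and (P Q : nat -> Prop) :
  eventually P -> eventually Q -> eventually (fun n => P n /\ Q n).
Proof.
  intros [N HN] [M HM]. exists (max N M). intros n Hn. split; [apply HN|apply HM]; lia.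
Qed.

Lemma eventually_ex (P : nat -> Prop) : eventually P -> exists n, P n.
Proof. intros [N HN]. exists N. apply HN. lia. Qed.

Lemma eventually_list {I : Type} (P : I -> nat -> Prop) (l : list I) :
  (forall i, In i l -> eventually (P i)) -> eventually (fun n => forall i, In i l -> P i n).
Proof.
  induction l as [|a l IH]; intros H; [exists 0%nat; intros n _ i []|].
  destruct (eventually_and (P a) (fun n => forall i, In i l -> P i n)) as [N HN].
  - apply H. left. reflexivity.
  - apply IH. intros i Hi. apply H. right. exact Hi.
  - exists N. intros n Hn i [<-|Hi]; [exact (proj1 (HN n Hn))|exact (proj2 (HN n Hn) i Hi)].
Qed.

Lemma eventually_lt (P : nat -> nat -> Prop) (k : nat) :
  (forall m, eventually (P m)) -> eventually (fun n => forall m, (m < k)%nat -> P m n).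
Proof.
  intros H. destruct (eventually_list P (seq 0 k)) as [N HN]; [auto|].
  exists N. intros n Hn m Hm. apply (HN n Hn), in_seq. lia.
Qed.

Lemma inv_INR_S_lt (m n : nat) : / INR (S m) < / INR (S n) <-> (n < m)%nat.
Proof.
  assert (H : forall a b, (b < a)%nat -> / INR (S a) < / INR (S b)).
  { intros a b Hab. apply Rinv_lt_contravar; [|apply lt_INR; lia].
    apply Rmult_lt_0_compat; apply lt_0_INR; lia. }
  split; [|apply H]. intros Hlt. destruct (le_lt_dec m n) as [Hmn|Hmn]; [|exact Hmn].
  destruct (Nat.eq_dec m n) as [->|Hne]; [lra|].
  pose proof (H n m ltac:(lia)). lra.
Qed.

(** The value is [/ INR (S N)] for the least [N] at which [P] fails, and [0] if it never fails. *)
Lemma first_failure (P : nat -> Prop) : exists v,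
  (v = 0 \/ exists n, v = / INR (S n)) /\
  forall n, v < / INR (S n) <-> forall m, (m < S n)%nat -> P m.
Proof.
  destruct (classic (exists n, ~ P n)) as [Hex|Hall].
  - destruct (least_nat _ Hex) as [N [HN Hmin]]. exists (/ INR (S N)).
    split; [right; exists N; reflexivity|]. intros n. rewrite inv_INR_S_lt. split.
    + intros Hn m Hm. apply NNPP. intros Pm. pose proof (Hmin m Pm). lia.
    + intros H. destruct (le_lt_dec N n) as [Hle|Hlt]; [|exact Hlt].
      exfalso. apply HN, H. lia.
  - exists 0. split; [left; reflexivity|]. intros n. split.
    + intros _ m _. apply NNPP. intros Pm. apply Hall. exists m. exact Pm.
    + intros _. apply inv_INR_S_pos.
Qed.

(** The distance is governed by the first preorder that fails. Transitivity gives the ultrametric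
    inequality, which is stronger than the triangle inequality. *)
Lemma preorders_quasi_metric {X : Type} (Rl : nat -> X -> X -> Prop) :
  (forall n x, Rl n x x) ->
  (forall n x y z, Rl n x y -> Rl n y z -> Rl n x z) ->
  (forall x y, (forall n, Rl n x y) -> (forall n, Rl n y x) -> x = y) ->
  exists d, is_quasi_metric d /\
    forall x y n, d x y < / INR (S n) <-> forall m, (m < S n)%nat -> Rl m x y.
Proof.
  intros Hrefl Htrans Hanti.
  destruct (choice (fun (p : X * X) v => (v = 0 \/ exists n, v = / INR (S n)) /\
    forall n, v < / INR (S n) <-> forall m, (m < S n)%nat -> Rl m (fst p) (snd p)))
    as [d' Hd']; [intros p; apply first_failure|].
  exists (fun x y => d' (x, y)).
  assert (Hlt : forall x y n, d' (x, y) < / INR (S n) <->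
            forall m, (m < S n)%nat -> Rl m x y) by (intros x y; apply (Hd' (x, y))).
  assert (Hval : forall x y, d' (x, y) = 0 \/ exists n, d' (x, y) = / INR (S n))
    by (intros x y; apply (Hd' (x, y))).
  assert (Hpos : forall x y, 0 <= d' (x, y)).
  { intros x y. destruct (Hval x y) as [->|[n ->]]; [lra|].
    pose proof (inv_INR_S_pos n). lra. }
  split; [|exact Hlt].
  split; [exact Hpos|]. split; [|split].
  - intros x. destruct (Hval x x) as [H|[n H]]; [exact H|].
    assert (d' (x, x) < / INR (S n)) by (apply Hlt; intros m _; apply Hrefl). lra.
  - intros x y z. pose proof (Hpos x y). pose proof (Hpos y z).
    destruct (Hval x z) as [->|[n Hn]]; [lra|].
    apply Rnot_lt_le. intros H1.
    assert (Hxy : d' (x, y) < / INR (S n)) by lra.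
    assert (Hyz : d' (y, z) < / INR (S n)) by lra.
    rewrite Hlt in Hxy, Hyz.
    assert (d' (x, z) < / INR (S n)) by (apply Hlt; eauto). lra.
  - intros x y H1 H2. apply Hanti; intros n.
    + assert (H : d' (x, y) < / INR (S n)) by (rewrite H1; apply inv_INR_S_pos).
      rewrite Hlt in H. apply H. lia.
    + assert (H : d' (y, x) < / INR (S n)) by (rewrite H2; apply inv_INR_S_pos).
      rewrite Hlt in H. apply H. lia.
Qed.

Lemma base_separates {X : Type} (O : (X -> Prop) -> Prop) (B : nat -> X -> Prop) x y :
  T0 O -> is_base O B -> (forall i, B i x <-> B i y) -> x = y.
Proof.
  intros HT0 HB H. apply NNPP. intros Hne. destruct (HT0 x y Hne) as [U [OU HU]].
  apply HU. split; intros Hin.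
  - destruct (proj2 HB U OU x Hin) as [i [Bi Hi]]. apply Hi, H, Bi.
  - destruct (proj2 HB U OU y Hin) as [i [Bi Hi]]. apply Hi, H, Bi.
Qed.

(** * Ranks of points at sets of indices *)

Section Rank.
Context {X : Type}.
Variables (B : nat -> X -> Prop) (C : nat -> nat -> Prop).

(* The rank of x at n is the least j with C n j and B j x; it is encoded as j + 1,
   and as 0 when there is no such j. *)
Definition has_rank (n : nat) (x : X) (v : nat) : Prop :=
  match v with
  | 0%nat => forall j, C n j -> ~ B j x
  | S j => C n j /\ B j x /\ forall j', C n j' -> B j' x -> (j <= j')%nat
  end.

(** The rank of [y] is at most that of [x], a missing rank counting as infinite; the code [0] of
    [has_rank] plays no part in this order. *)
Definition rank_le (n : nat) (x y : X) : Prop :=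
  forall j, C n j -> B j x -> exists j', (j' <= j)%nat /\ C n j' /\ B j' y.

Lemma rank_exists n x : exists v, has_rank n x v.
Proof.
  destruct (classic (exists j, C n j /\ B j x)) as [Hex|Hno].
  - destruct (least_nat _ Hex) as [j [[Cj Bj] Hmin]]. exists (S j).
    split; [exact Cj|]. split; [exact Bj|]. auto.
  - exists 0%nat. intros j Cj Bj. apply Hno. exists j. auto.
Qed.

Lemma same_rank_le n x y v : has_rank n x v -> has_rank n y v -> rank_le n x y.
Proof.
  destruct v as [|v]; intros Hx Hy j Cj Bj; [destruct (Hx j Cj Bj)|].
  exists v. split; [apply Hx; assumption|]. split; apply Hy.
Qed.

Lemma rank_le_refl n x : rank_le n x x.
Proof. intros j Cj Bj. exists j. auto. Qed.

Lemma rank_le_trans n x y z : rank_le n x y -> rank_le n y z -> rank_le n x z.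
Proof.
  intros Hxy Hyz j Cj Bj. destruct (Hxy j Cj Bj) as [j' [Hj [Cj' Bj']]].
  destruct (Hyz j' Cj' Bj') as [j'' [Hj' [Cj'' Bj'']]]. exists j''. split; [lia|auto].
Qed.

(** On a tail the ranks are nonincreasing, so they stay at the least rank once it is reached. *)
Lemma rank_stabilizes n (s : nat -> X) :
  (exists N, forall p q, (N <= p)%nat -> (p <= q)%nat -> rank_le n (s p) (s q)) ->
  exists v, eventually (fun l => has_rank n (s l) v).
Proof.
  intros [N HN].
  destruct (classic (exists j p, (N <= p)%nat /\ C n j /\ B j (s p))) as [Hex|Hno].
  - destruct (least_nat _ Hex) as [j [[p [Hp [Cj Bj]]] Hmin]].
    exists (S j), p. intros q Hq. split; [exact Cj|].
    destruct (HN p q Hp Hq j Cj Bj) as [j' [Hj' [Cj' Bj']]]. split.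
    + replace j with j'; [exact Bj'|]. apply Nat.le_antisymm; [exact Hj'|].
      apply Hmin. exists q. split; [lia|auto].
    + intros j'' Cj'' Bj''. apply Hmin. exists q. split; [lia|auto].
  - exists 0%nat, N. intros q Hq j Cj Bj. apply Hno. exists j, q. auto.
Qed.

Lemma rank_limit n (s : nat -> X) x v :
  (forall i, eventually (fun l => B i (s l)) <-> B i x) ->
  eventually (fun l => has_rank n (s l) v) -> has_rank n x v.
Proof.
  intros Hx Hv. destruct v as [|j].
  - intros j Cj Bj. apply Hx in Bj.
    destruct (eventually_ex _ (eventually_and _ _ Bj Hv)) as [l [Bl Hl]]. exact (Hl j Cj Bl).
  - split; [destruct (eventually_ex _ Hv) as [l Hl]; apply Hl|]. split.
    + apply Hx. destruct Hv as [N HN]. exists N. intros l Hl. apply (HN l Hl).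
    + intros j' Cj' Bj'. apply Hx in Bj'.
      destruct (eventually_ex _ (eventually_and _ _ Bj' Hv)) as [l [Bl Hl]].
      apply Hl; assumption.
Qed.

(** If [j] is the rank of [x], every point of [B j] has rank at most [j]; if there is no rank,
    nothing is required. *)
Lemma rank_le_nbhd O n x : is_topology O -> (forall i, O (B i)) ->
  exists V, O V /\ V x /\ forall y, V y -> rank_le n x y.
Proof.
  intros Htop HB. destruct (rank_exists n x) as [[|j] Hr].
  - exists (fun _ => True). split; [apply (open_full Htop)|]. split; [exact I|].
    intros y _ j Cj Bj. destruct (Hr j Cj Bj).
  - exists (B j). split; [apply HB|]. split; [apply Hr|].
    intros y By j' Cj' Bj'. exists j. split; [apply Hr; assumption|].
    split; [apply Hr|exact By].
Qed.

Lemma rank_le_nbhd_lt O k x : is_topology O -> (forall i, O (B i)) ->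
  exists V, O V /\ V x /\ forall y, V y -> forall m, (m < k)%nat -> rank_le m x y.
Proof.
  intros Htop HB. induction k as [|k [V [OV [Vx HV]]]].
  - exists (fun _ => True). split; [apply (open_full Htop)|]. split; [exact I|].
    intros y _ m Hm. lia.
  - destruct (rank_le_nbhd O k x Htop HB) as [V' [OV' [Vx' HV']]].
    exists (fun y => V y /\ V' y). split; [apply (open_inter Htop); assumption|].
    split; [auto|]. intros y [Vy Vy'] m Hm.
    destruct (Nat.eq_dec m k) as [->|Hne]; [auto|]. apply HV; [exact Vy|lia].
Qed.

Lemma rank_pattern_exists k x : exists c : list nat,
  length c = k /\ forall m, (m < k)%nat -> has_rank m x (nth m c 0%nat).
Proof.
  induction k as [|k [c [Hlen Hc]]]; [exists nil; split; [reflexivity|intros m Hm; lia]|].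
  destruct (rank_exists k x) as [v Hv]. exists (c ++ v :: nil). split.
  - rewrite length_app. simpl. lia.
  - intros m Hm. destruct (Nat.eq_dec m k) as [->|Hne].
    + rewrite <- Hlen at 2. rewrite nth_middle. exact Hv.
    + rewrite app_nth1 by lia. apply Hc. lia.
Qed.

End Rank.

(* Two points are close when their ranks at the first few sets W n, and at the
   first few singletons, agree; along a Cauchy sequence each rank is eventually
   constant, so the witnesses demanded by the axioms survive in the limit. *)
Lemma presentable_quasi_Polish {X : Type} (O : (X -> Prop) -> Prop) :
  is_topology O -> T0 O -> presentable O -> quasi_Polish O.
Proof.
  intros Htop HT0 [B [F [W [HB [Hsound Hcompl]]]]].
  destruct (enumerable_sum nat nat enumerable_nat enumerable_nat) as [e He].
  pose (C := fun n => match e n with inl k => eq k | inr i => W i end).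
  assert (HCk : forall k, exists n, C n = eq k).
  { intros k. destruct (He (inl k)) as [n Hn]. exists n. unfold C. rewrite Hn. reflexivity. }
  assert (HCW : forall i, exists n, C n = W i).
  { intros i. destruct (He (inr i)) as [n Hn]. exists n. unfold C. rewrite Hn. reflexivity. }
  (* At the singleton of [k], comparing ranks amounts to preserving membership in [B k]. *)
  assert (HCB : forall k, exists n, forall x y, rank_le B C n x y -> B k x -> B k y).
  { intros k. destruct (HCk k) as [n Hn]. exists n. intros x y Hxy Bx.
    unfold rank_le in Hxy. rewrite Hn in Hxy.
    destruct (Hxy k eq_refl Bx) as [j' [_ [<- By]]]. exact By. }
  destruct (preorders_quasi_metric (rank_le B C)) as [d [Hd Hlt]].
  { apply rank_le_refl. }
  { apply rank_le_trans. }
  { intros x y Hxy Hyx. apply (base_separates O B x y HT0 HB). intros k.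
    destruct (HCB k) as [n Hn]. split; apply Hn; auto. }
  assert (Hsmall : forall eps, 0 < eps -> exists n, forall x y,
            (forall m, (m < S n)%nat -> rank_le B C m x y) -> d x y < eps).
  { intros eps Heps. destruct (small_inv eps Heps) as [n Hn]. exists n.
    intros x y Hxy. apply Rlt_trans with (/ INR (S n)); [apply Hlt, Hxy|apply Hn; lia]. }
  assert (Hsym : forall eps, 0 < eps -> exists n, forall x y c,
            (forall m, (m < S n)%nat -> has_rank B C m x (c m) /\ has_rank B C m y (c m)) ->
            dsym d x y < eps).
  { intros eps Heps. destruct (Hsmall eps Heps) as [n Hn]. exists n. intros x y c Hc.
    apply Rmax_lub_lt; apply Hn; intros m Hm;
      apply same_rank_le with (c m); apply (Hc m Hm). }
  exists X, d. split; [exact Hd|]. split; [|split].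
  - intros s Hs.
    assert (Hst : forall n, exists v, eventually (fun l => has_rank B C n (s l) v)).
    { intros n. apply rank_stabilizes.
      destruct (Hs (/ INR (S n)) (inv_INR_S_pos n)) as [N HN]. exists N. intros p q Hp Hpq.
      apply (proj1 (Hlt _ _ n) (HN p q Hp Hpq)). lia. }
    destruct (choice _ Hst) as [v Hv].
    destruct (Hcompl (fun i => eventually (fun l => B i (s l)))) as [x Hx].
    (* The finitely many premises hold jointly far along the sequence, so the stable rank at [W i]
       is not [0]; it names one witness valid for all late terms. *)
    { intros i Hprem. destruct (HCW i) as [n Hn].
      pose proof (eventually_list (fun k l => B k (s l)) (F i) Hprem) as Hall.
      destruct (eventually_ex _ (eventually_and _ _ Hall (Hv n))) as [l [Hl Hrank]].
      destruct (Hsound (s l) i Hl) as [j [Wj Bj]].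
      destruct (v n) as [|j0] eqn:Ev.
      - exfalso. rewrite <- Hn in Wj. exact (Hrank j Wj Bj).
      - exists j0. rewrite <- Hn. split; [apply Hrank|].
        destruct (Hv n) as [N HN]. rewrite Ev in HN. exists N. intros l' Hl'. apply (HN l' Hl'). }
    exists x. intros U HU Ux. destruct (HU x Ux) as [eps [Heps HepsU]].
    destruct (Hsym eps Heps) as [n Hn].
    destruct (eventually_lt (fun m l => has_rank B C m (s l) (v m)) (S n) Hv) as [N HN].
    exists N. intros l Hl. apply HepsU, (Hn x (s l) v). intros m Hm.
    split; [exact (rank_limit B C m s x (v m) Hx (Hv m))|exact (HN l Hl m Hm)].
  - destruct (enumerable_list nat enumerable_nat) as [code Hcode].
    (* Choosing a point for each realised finite pattern of ranks gives a countable dense set. *)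
    pose (pat := fun c x => forall m, (m < length c)%nat -> has_rank B C m x (nth m c 0%nat)).
    destruct (choice (fun n (o : option X) =>
      match o with Some x => pat (code n) x | None => ~ exists x, pat (code n) x end))
      as [o Ho].
    { intros n. destruct (classic (exists x, pat (code n) x)) as [[x Hx]|Hno];
        [exists (Some x); exact Hx|exists None; exact Hno]. }
    exists (fun x => exists n, o n = Some x). split; [exists o; tauto|].
    intros U HU [x Ux]. destruct (HU x Ux) as [eps [Heps HepsU]].
    destruct (Hsym eps Heps) as [n Hn].
    destruct (rank_pattern_exists B C (S n) x) as [c [Hlen Hc]].
    destruct (Hcode c) as [k Hk]. pose proof (Ho k) as Hok. rewrite Hk in Hok.
    destruct (o k) as [a|] eqn:Ea.
    + exists a. split; [exists k; exact Ea|].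
      apply HepsU, (Hn x a (fun m => nth m c 0%nat)). intros m Hm. split; [exact (Hc m Hm)|].
      apply Hok. lia.
    + exfalso. apply Hok. exists x. intros m Hm. apply Hc. lia.
  - exists (fun x => x), (fun x => x). split; [reflexivity|]. split; [reflexivity|]. split.
    + intros V HV. apply (open_of_nbhds Htop). intros x Vx.
      destruct (HV x Vx) as [eps [Heps HepsV]]. destruct (Hsmall eps Heps) as [n Hn].
      destruct (rank_le_nbhd_lt B C O (S n) x Htop (proj1 HB)) as [G [OG [Gx HG]]].
      exists G. split; [exact OG|]. split; [exact Gx|]. intros y Gy.
      apply HepsV, Hn, HG, Gy.
    + intros V OV x Vx. destruct (proj2 HB V OV x Vx) as [k [Bk Hk]].
      destruct (HCB k) as [n Hn]. exists (/ INR (S n)). split; [apply inv_INR_S_pos|].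
      intros y Hy. apply Hk. apply (Hn x y); [|exact Bk].
      apply (proj1 (Hlt x y n) Hy). lia.
Qed.

(** * Presentable spaces are domain-complete *)

Section Ideals.
Context {P : Type} {pre : P -> P -> Prop}.
Hypothesis pre_refl : forall p, pre p p.
Hypothesis pre_trans : forall p q r, pre p q -> pre q r -> pre p r.

Definition is_ideal (J : P -> Prop) : Prop :=
  (forall p q, J q -> pre p q -> J p) /\ directed pre J.

Definition ideals : Type := {J : P -> Prop | is_ideal J}.

Definition ideal_le (I J : ideals) : Prop := subset (proj1_sig I) (proj1_sig J).

Lemma principal_is_ideal p : is_ideal (fun q => pre q p).
Proof.
  split; [intros q r Hr Hqr; eauto|]. split; [exists p; auto|].
  intros q r Hq Hr. exists p. auto.
Qed.

Definition principal (p : P) : ideals := exist _ _ (principal_is_ideal p).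

Lemma principal_le p (J : ideals) : proj1_sig J p -> ideal_le (principal p) J.
Proof. intros Hp q Hq. exact (proj1 (proj2_sig J) q p Hp Hq). Qed.

Lemma directed_union_is_ideal (A : ideals -> Prop) : directed ideal_le A ->
  is_ideal (fun p => exists J, A J /\ proj1_sig J p).
Proof.
  intros [[J0 AJ0] HA]. split; [|split].
  - intros p q [J [AJ Jq]] Hpq. exists J. split; [exact AJ|].
    exact (proj1 (proj2_sig J) p q Jq Hpq).
  - destruct (proj1 (proj2 (proj2_sig J0))) as [p Hp]. exists p, J0. auto.
  - intros p q [J [AJ Jp]] [K [AK Kq]]. destruct (HA J K AJ AK) as [L [AL [HJ HK]]].
    destruct (proj2 (proj2 (proj2_sig L)) p q (HJ p Jp) (HK q Kq)) as [r [Lr Hr]].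
    exists r. split; [exists L; auto|exact Hr].
Qed.

Lemma directed_union_sup (A : ideals -> Prop) (HA : directed ideal_le A) :
  is_sup ideal_le A (exist _ _ (directed_union_is_ideal A HA)).
Proof.
  split.
  - intros J AJ p Jp. exists J. auto.
  - intros K HK p [J [AJ Jp]]. exact (HK J AJ p Jp).
Qed.

Lemma ideal_sup_mem (A : ideals -> Prop) s p :
  directed ideal_le A -> is_sup ideal_le A s -> proj1_sig s p ->
  exists J, A J /\ proj1_sig J p.
Proof.
  intros HA Hs Hp. exact (proj2 Hs _ (proj1 (directed_union_sup A HA)) p Hp).
Qed.

Lemma ideal_le_poset : is_poset ideal_le.
Proof.
  split; [intros I p Hp; exact Hp|]. split; [intros I J K HIJ HJK p Hp; auto|].
  intros [I HI] [J HJ] H1 H2. apply subset_eq_compat. apply pred_ext.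
  intros p. split; [apply H1|apply H2].
Qed.

Lemma principal_way_below p (J : ideals) : proj1_sig J p -> way_below ideal_le (principal p) J.
Proof.
  intros Jp A s HA Hs HJs. destruct (ideal_sup_mem A s p HA Hs (HJs p Jp)) as [K [AK Kp]].
  exists K. split; [exact AK|apply principal_le, Kp].
Qed.

Lemma principals_below_directed (J : ideals) :
  directed ideal_le (fun I => exists p, proj1_sig J p /\ I = principal p).
Proof.
  split.
  - destruct (proj1 (proj2 (proj2_sig J))) as [p Jp]. exists (principal p), p. auto.
  - intros I K [p [Jp ->]] [q [Jq ->]].
    destruct (proj2 (proj2 (proj2_sig J)) p q Jp Jq) as [r [Jr [Hpr Hqr]]].
    exists (principal r). split; [exists r; auto|]. split; apply principal_le; assumption.
Qed.

Lemma principals_below_sup (J : ideals) :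
  is_sup ideal_le (fun I => exists p, proj1_sig J p /\ I = principal p) J.
Proof.
  split; [intros I [p [Jp ->]]; apply principal_le, Jp|].
  intros K HK p Jp. apply (HK (principal p)); [exists p; auto|apply pre_refl].
Qed.

Lemma way_below_principal (I J : ideals) : way_below ideal_le I J ->
  exists p, proj1_sig J p /\ ideal_le I (principal p).
Proof.
  intros H.
  destruct (H _ J (principals_below_directed J) (principals_below_sup J)) as [K [[p [Jp ->]] HI]];
    [intros q Jq; exact Jq|].
  exists p. auto.
Qed.

(** The principal ideals of members of [J] are way below [J], and every ideal way below [J] lies in
    one of them, so they are cofinal there. *)
Lemma ideals_continuous_dcpo : is_continuous_dcpo ideal_le.
Proof.
  split.
  - split; [exact ideal_le_poset|]. intros A HA. eexists. apply (directed_union_sup A HA).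
  - intros J. split; [split|split].
    + destruct (proj1 (proj2 (proj2_sig J))) as [p Jp].
      exists (principal p). apply principal_way_below, Jp.
    + intros I K HI HK. destruct (way_below_principal I J HI) as [p [Jp Hp]].
      destruct (way_below_principal K J HK) as [q [Jq Hq]].
      destruct (proj2 (proj2 (proj2_sig J)) p q Jp Jq) as [r [Jr [Hpr Hqr]]].
      exists (principal r). split; [apply principal_way_below, Jr|].
      split; intros x Hx; [apply Hp in Hx|apply Hq in Hx]; simpl in *; eauto.
    + intros I HI. destruct (way_below_principal I J HI) as [p [Jp Hp]].
      intros q Hq. exact (principal_le p J Jp q (Hp q Hq)).
    + intros K HK p Jp. apply (HK (principal p)); [apply principal_way_below, Jp|apply pre_refl].
Qed.

Lemma scott_open_ideals_mem (Q : P -> Prop) :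
  scott_open ideal_le (fun J => exists p, proj1_sig J p /\ Q p).
Proof.
  split.
  - intros I J [p [Ip Qp]] HIJ. exists p. auto.
  - intros A s HA Hs [p [sp Qp]]. destruct (ideal_sup_mem A s p HA Hs sp) as [J [AJ Jp]].
    exists J. split; [exact AJ|]. exists p. auto.
Qed.

Lemma scott_open_principal (V : ideals -> Prop) (J : ideals) :
  scott_open ideal_le V -> V J -> exists p, proj1_sig J p /\ V (principal p).
Proof.
  intros [_ HV] VJ.
  destruct (HV _ J (principals_below_directed J) (principals_below_sup J) VJ)
    as [K [[p [Jp ->]] Vp]]. exists p. auto.
Qed.

End Ideals.

(** * Unbounded ideals of finite stages *)

Section PresentedDomain.
Variables (F : nat -> list nat) (W : nat -> nat -> Prop).

(* A finite stage (K, n) commits to the indices in K; a strictly larger stage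
   has to satisfy the first n axioms whose premises hold in K. *)
Definition stage : Type := list nat * nat.

Definition refines (p q : stage) : Prop :=
  incl (fst p) (fst q) /\ (snd p < snd q)%nat /\
  forall i, (i < snd p)%nat -> incl (F i) (fst p) -> exists j, W i j /\ In j (fst q).

Definition stage_le (p q : stage) : Prop := p = q \/ refines p q.

Lemma refines_weaken p p' q q' : incl (fst p) (fst p') -> (snd p <= snd p')%nat ->
  incl (fst q) (fst q') -> (snd q <= snd q')%nat -> refines p' q -> refines p q'.
Proof.
  intros H1 H2 H3 H4 [K1 [K2 K3]]. split; [|split].
  - intros i Hi. auto.
  - lia.
  - intros i Hi HF. destruct (K3 i) as [j [Wj Hj]]; [lia|intros k Hk; auto|].
    exists j. auto.
Qed.

Lemma stage_le_incl p q : stage_le p q -> incl (fst p) (fst q) /\ (snd p <= snd q)%nat.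
Proof.
  intros [<-|[H1 [H2 _]]]; [split; [apply incl_refl|lia]|split; [exact H1|lia]].
Qed.

Lemma stage_le_refl p : stage_le p p.
Proof. left. reflexivity. Qed.

Lemma stage_le_trans p q r : stage_le p q -> stage_le q r -> stage_le p r.
Proof.
  intros [<-|H1] [<-|H2]; [left; reflexivity|right; exact H2|right; exact H1|].
  right. pose proof H1 as [K1 [K2 _]].
  apply refines_weaken with q r; [exact K1|lia|apply incl_refl|lia|exact H2].
Qed.

Definition unbounded (J : @ideals stage stage_le) : Prop :=
  forall n, exists p, proj1_sig J p /\ (n <= snd p)%nat.

Definition support (J : @ideals stage stage_le) (i : nat) : Prop :=
  exists p, proj1_sig J p /\ In i (fst p).

Lemma unbounded_G_delta : G_delta (scott_open (@ideal_le stage stage_le)) unbounded.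
Proof.
  exists (fun n J => exists p, proj1_sig J p /\ (n <= snd p)%nat). split; [|tauto].
  intros n. apply scott_open_ideals_mem.
Qed.

Lemma unbounded_above J p n : unbounded J -> proj1_sig J p ->
  exists q, proj1_sig J q /\ refines p q /\ (n <= snd q)%nat.
Proof.
  (* A level above [snd p] excludes equality, so the common upper bound strictly refines [p]. *)
  intros HJ Jp. destruct (HJ (max n (S (snd p)))) as [r [Jr Hr]].
  destruct (proj2 (proj2 (proj2_sig J)) p r Jp Jr) as [q [Jq [Hpq Hrq]]].
  pose proof (stage_le_incl r q Hrq) as [_ Hlev].
  exists q. split; [exact Jq|]. split; [|lia].
  destruct Hpq as [<-|H]; [lia|exact H].
Qed.

Lemma support_finite J K n : unbounded J -> (forall i, In i K -> support J i) ->
  exists p, proj1_sig J p /\ incl K (fst p) /\ (n <= snd p)%nat.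
Proof.
  intros HJ. induction K as [|a K IH]; intros HK.
  - destruct (HJ n) as [p [Jp Hp]]. exists p. split; [exact Jp|]. split; [intros i []|exact Hp].
  - destruct IH as [p [Jp [HKp Hn]]]; [intros i Hi; apply HK; right; exact Hi|].
    destruct (HK a (or_introl eq_refl)) as [q [Jq Hq]].
    destruct (proj2 (proj2 (proj2_sig J)) p q Jp Jq) as [r [Jr [Hpr Hqr]]].
    apply stage_le_incl in Hpr, Hqr. exists r. split; [exact Jr|]. split; [|lia].
    intros i [<-|Hi]; [apply Hqr, Hq|apply Hpr, HKp, Hi].
Qed.

(** An unbounded ideal is determined by its support: some [q] in it dominates both components of
    [p], and a strict refinement of [q] then also refines [p]. *)
Lemma unbounded_mem J p : unbounded J ->
  proj1_sig J p <-> forall i, In i (fst p) -> support J i.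
Proof.
  intros HJ. split; [intros Jp i Hi; exists p; auto|].
  intros Hp. destruct (support_finite J (fst p) (snd p) HJ Hp) as [q [Jq [Hq Hn]]].
  destruct (unbounded_above J q 0 HJ Jq) as [r [Jr [Hqr _]]].
  apply (proj1 (proj2_sig J) p r Jr). right.
  apply refines_weaken with q r; [exact Hq|exact Hn|apply incl_refl|lia|exact Hqr].
Qed.

(** A stage of level at least [S n] containing the premise has a strict refinement in [J], which
    must contain a witness of axiom [n]. *)
Lemma support_model J : unbounded J -> is_model F W (support J).
Proof.
  intros HJ n Hprem. destruct (support_finite J (F n) (S n) HJ Hprem) as [p [Jp [Hp Hn]]].
  destruct (unbounded_above J p 0 HJ Jp) as [q [Jq [[_ [_ Hq]] _]]].
  destruct (Hq n) as [j [Wj Hj]]; [lia|exact Hp|].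
  exists j. split; [exact Wj|]. exists q. auto.
Qed.

Lemma model_witnesses A n : is_model F W A -> exists K, (forall j, In j K -> A j) /\
  forall i, (i < n)%nat -> (forall k, In k (F i) -> A k) -> exists j, W i j /\ In j K.
Proof.
  intros HA. induction n as [|n [K [HK1 HK2]]].
  - exists nil. split; [intros j []|intros i Hi; lia].
  - destruct (classic (forall k, In k (F n) -> A k)) as [Hprem|Hprem].
    + destruct (HA n Hprem) as [j [Wj Aj]]. exists (j :: K). split.
      * intros j' [<-|Hj']; auto.
      * intros i Hi Hpi. destruct (Nat.eq_dec i n) as [->|Hne].
        -- exists j. split; [exact Wj|left; reflexivity].
        -- destruct (HK2 i) as [j' [Wj' Hj']]; [lia|exact Hpi|].
           exists j'. split; [exact Wj'|right; exact Hj'].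
    + exists K. split; [exact HK1|]. intros i Hi Hpi.
      destruct (Nat.eq_dec i n) as [->|Hne]; [tauto|]. apply HK2; [lia|exact Hpi].
Qed.

Lemma model_is_ideal A : is_model F W A ->
  @is_ideal stage stage_le (fun p => forall i, In i (fst p) -> A i).
Proof.
  intros HA. split; [|split].
  - intros p q Hq Hpq i Hi. apply Hq. apply (stage_le_incl p q Hpq), Hi.
  - exists (nil, 0%nat). intros i [].
  - intros p q Hp Hq. destruct (model_witnesses A (max (snd p) (snd q)) HA) as [K [HK1 HK2]].
    (* Adding the witnesses [K] discharges the obligations of both stages, and the level exceeds
       both. *)
    exists (fst p ++ fst q ++ K, S (max (snd p) (snd q))). split; [|split].
    + intros i Hi. simpl in Hi. rewrite !in_app_iff in Hi. destruct Hi as [Hi|[Hi|Hi]]; auto.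
    + right. split; [|split]; simpl fst; simpl snd.
      * intros i Hi. rewrite in_app_iff. auto.
      * lia.
      * intros i Hi HF. destruct (HK2 i) as [j [Wj Hj]]; [lia|auto|].
        exists j. split; [exact Wj|]. rewrite !in_app_iff. auto.
    + right. split; [|split]; simpl fst; simpl snd.
      * intros i Hi. rewrite !in_app_iff. auto.
      * lia.
      * intros i Hi HF. destruct (HK2 i) as [j [Wj Hj]]; [lia|auto|].
        exists j. split; [exact Wj|]. rewrite !in_app_iff. auto.
Qed.

End PresentedDomain.

(** A point corresponds to the ideal of stages whose indices all name neighbourhoods of it;
    conversely the support of an unbounded ideal is a model and hence comes from a point. *)
Lemma presentable_domain_complete {X : Type} (O : (X -> Prop) -> Prop) :
  is_topology O -> T0 O -> presentable O -> domain_complete O.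
Proof.
  intros Htop HT0 [B [F [W [HB [Hsound Hcompl]]]]].
  pose (le := @ideal_le (stage) (stage_le F W)).
  exists (@ideals stage (stage_le F W)), le.
  split; [apply ideals_continuous_dcpo; [apply stage_le_refl|apply stage_le_trans]|].
  exists (unbounded F W). split; [apply unbounded_G_delta|].
  pose (fJ := fun x => exist _ _ (model_is_ideal F W _ (Hsound x)) : @ideals stage (stage_le F W)).
  assert (Hf : forall x, unbounded F W (fJ x)).
  { intros x n. exists (nil, n). split; [intros i []|simpl; lia]. }
  assert (Hsupp : forall x i, support F W (fJ x) i <-> B i x).
  { intros x i. split.
    - intros [p [Hp Hi]]. exact (Hp i Hi).
    - intros Bi. exists (i :: nil, 0%nat). split; [|left; reflexivity].
      intros k [<-|[]]. exact Bi. }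
  pose (f := fun x => exist (unbounded F W) (fJ x) (Hf x)).
  destruct (choice (fun (J : {J | unbounded F W J}) x =>
      forall i, support F W (proj1_sig J) i <-> B i x)) as [g Hg].
  { intros [J HJ]. apply Hcompl, support_model, HJ. }
  exists f, g. split; [|split; [|split]].
  - intros x. apply (base_separates O B _ _ HT0 HB). intros i.
    rewrite <- (Hg (f x)). apply Hsupp.
  - intros [J HJ]. apply subset_eq_compat.
    destruct (ideal_le_poset (pre := stage_le F W)) as [_ [_ Hanti]].
    apply Hanti; intros p Hp.
    + apply (unbounded_mem F W J p HJ). intros i Hi. apply (Hg (exist _ J HJ)). exact (Hp i Hi).
    + intros i Hi. apply (Hg (exist _ J HJ)). exists p. auto.
  (* A Scott neighbourhood of the ideal of [x] contains a principal ideal below it; a stage commits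
     to finitely many indices, so a finite intersection of basic sets maps into it. *)
  - intros U [V [HV HUV]]. apply (open_of_nbhds Htop). intros x Ux.
    apply HUV in Ux.
    destruct (scott_open_principal (stage_le_refl F W) (stage_le_trans F W) V (fJ x) HV Ux)
      as [p [Hp Vp]].
    exists (fun y => forall i, In i (fst p) -> B i y).
    split; [apply (open_list_inter Htop), HB|]. split; [exact Hp|].
    intros y Hy. apply HUV. apply (proj1 HV _ _ Vp). apply principal_le. exact Hy.
  - intros U OU.
    exists (fun J => exists p, proj1_sig J p /\ exists i, In i (fst p) /\ subset (B i) U).
    split; [apply scott_open_ideals_mem|].
    intros J. split.
    + intros Ug. destruct (proj2 HB U OU _ Ug) as [i [Bi Hi]].
      apply (Hg J) in Bi. destruct Bi as [p [Jp Hip]]. exists p. split; [exact Jp|].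
      exists i. auto.
    + intros [p [Jp [i [Hip Hi]]]]. apply Hi, (Hg J). exists p. auto.
Qed.

Theorem theorem9p5 (X : Type) (O : (X -> Prop) -> Prop)
  (Htop : is_topology O) (HT0 : T0 O) (Hcb : countably_based O) :
  (domain_complete O <-> LCS_complete O) /\
  (LCS_complete O <-> quasi_Polish O) /\
  (quasi_Polish O <-> compactly_Choquet_complete O) /\
  (compactly_Choquet_complete O <-> convergence_Choquet_complete O).
Proof.
  pose proof (domain_complete_LCS_complete O).
  pose proof (LCS_compactly_Choquet O).
  pose proof (compactly_Choquet_presentable O Htop Hcb).
  pose proof (presentable_domain_complete O Htop HT0).
  pose proof (presentable_quasi_Polish O Htop HT0).
  pose proof (quasi_Polish_convergence_Choquet O).
  pose proof (convergence_compactly_Choquet O).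
  (* Presentability leads to domain-completeness, then LCS-completeness and the compact game, and
     also to quasi-Polishness, then the convergence game and the compact game; the compact game
     leads back to presentability. *)
  tauto.
Qed.
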